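(* Let $\{\mathscr F_n\}_{n\ge0}$ be a filtration. Let $\{V_n\}_{n\ge1}$ and $\{Y_n\}_{n\ge1}$ be nonnegative processes with $V_n,Y_n$ both $\mathscr F_{n-1}$-measurable and $Y_n\le V_n$ for all $n$. Suppose that for all $n\ge1$ $$V_{n+1}-V_n\le -c_DD_n+C_RR_n+C_H\widetilde R_n+M_n,$$ where $c_D,C_R,C_H>0$ are constants, $D_n\ge0$ is $\mathscr F_{n-1}$-measurable, $R_n,\widetilde R_n\ge0$ are integrable and $\mathscr F_n$-measurable, and $M_n$ is square integrable, $\mathscr F_n$-measurable, with $\mathbb E[M_n\mid\mathscr F_{n-1}]=0$. Fix a deterministic level $G>0$ with $V_1\le G$, and let $a_i,b_i,c_i$ ($i\ge1$) be the phase times defined in the context. Suppose there are deterministic constants $B_G,B_{2G}>0$ with $B_G<2G$, and finite nonnegative constants $\kappa_0,\kappa_1,\kappa_2,\kappa_3$, such that: (i) (Controlled crossings) for every $i$, $V_{a_i}\le B_G$ on $\{a_i<\infty\}$, and $V_{b_i}\le B_{2G}$ on $\{b_i<\infty,\ V_{b_i}>2G\}$. (ii) (Residual budgets) $$\sum_{n\ge1}\mathbb E[\mathbf 1_{\{V_n>G\}}R_n]<\infty,\qquad \sum_{n\ge1}\mathbb E[\mathbf 1_{\{V_n>G\}}\widetilde R_n]<\infty .$$ (iii) (Conditional quadratic variation on the entrance band) for every $n\ge1$, $$\mathbf 1_{\{G<V_n\le2G\}}\mathbb E[M_n^2\mid\mathscr F_{n-1}]\le\mathbf 1_{\{G<V_n\le2G\}}\Big[(\kappa_0+\kappa_1V_n+\kappa_2V_n^2)\,\mathbb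 E[R_n\mid\mathscr F_{n-1}]+\kappa_3\,\mathbb E[\widetilde R_n\mid\mathscr F_{n-1}]\Big].$$ (iv) (Target variation) there are finite constants $C_{Y,D},C_{Y,R},C_{Y,H}$ such that for every $n\ge1$ $$\mathbf 1_{\{V_n>G\}}\mathbb E[|Y_{n+1}-Y_n|\mid\mathscr F_{n-1}]\le\mathbf 1_{\{V_n>G\}}\Big(C_{Y,D}D_n+C_{Y,R}\,\mathbb E[R_n\mid\mathscr F_{n-1}]+C_{Y,H}\,\mathbb E[\widetilde R_n\mid\mathscr F_{n-1}]\Big).$$ Then $$\mathbb E\Big[\sup_{n\ge1}Y_n\Big]=\sup_{T\ge1}\mathbb E\Big[\max_{1\le n\le T}Y_n\Big]<\infty .$$ In particular, $\sup_{n\ge1}Y_n<\infty$ almost surely, and $\{Y_n\}_{n\ge1}$ is uniformly integrable.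
   Context: Phase times. With $c_0:=0$ and $\inf\varnothing:=\infty$, define recursively for $i\ge1$ $$a_i:=\inf\{n>c_{i-1}:V_n>G\},\quad b_i:=\inf\{n\ge a_i:V_n\le G\ \text{or}\ V_n>2G\},\quad c_i:=\inf\{n\ge b_i:V_n\le G\}.$$ If one of these sets is empty, that time and all subsequent times are set equal to $\infty$. *)

(* Defs.v *)
From HB Require Import structures.
From mathcomp Require Import all_boot all_order all_algebra.
From mathcomp Require Import all_classical all_reals all_analysis.
From mathcomp Require Import measurable_realfun.

Set Implicit Arguments.
Unset Strict Implicit.
Unset Printing Implicit Defensive.

Import Order.TTheory GRing.Theory Num.Theory.
Import numFieldNormedType.Exports.

Local Open Scope classical_set_scope.
Local Open Scope ring_scope.

Definition sub_sigma_algebra_of d (T : measurableType d) (H : set (set T)) :=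
  sigma_algebra [set: T] H /\ H `<=` d.-measurable.

Definition filtration d (T : measurableType d) (F : nat -> set (set T)) :=
  (forall n, sub_sigma_algebra_of (F n)) /\
  (forall m n, (m <= n)%N -> F m `<=` F n).

(* [g_sigma_algebraType H] carries the sigma-algebra generated by [H], which is
   [H] itself when [H] is a sigma-algebra ([measurable_g_measurableTypeE]). *)
Definition measurable_wrt d d' (T : measurableType d) (U : sigmaRingType d')
    (H : set (set T)) (f : T -> U) :=
  measurable_fun [set: g_sigma_algebraType H] (f : g_sigma_algebraType H -> U).

(* [Z] is a version of E[X | H]. The values of [Z] are extended reals so that
   the notion covers nonnegative [X] as well as integrable [X]. *)
Definition is_condexp d (T : measurableType d) (R : realType)
    (P : probability T R) (H : set (set T)) (X : T -> R) (Z : T -> \bar R) :=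
  measurable_wrt H Z /\
  forall A, H A -> (\int[P]_(w in A) Z w = \int[P]_(w in A) (X w)%:E)%E.

(* A fixed version of E[X | H]; see [condexpP] and [is_condexp_ae_unique]. *)
Definition condexp d (T : measurableType d) (R : realType)
    (P : probability T R) (H : set (set T)) (X : T -> R) : T -> \bar R :=
  xget (cst 0%E) [set Z | is_condexp P H X Z].

Notation "''E_' P [ X | H ]" := (condexp P H X)
  (at level 5, P, X, H at level 4, format "''E_' P [ X  |  H ]") : ereal_scope.

(* Times take values in nat together with infinity, encoded as [None]. *)
Definition inf_time (S : set nat) : option nat :=
  match pselect (exists n, `[< S n >]) with
  | left exS => Some (ex_minn exS)
  | right _ => None
  end.

Section phase_times.
Context (R : realType) (G : R) (v : nat -> R).

Definition next_a (c : option nat) : option nat :=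
  obind (fun m => inf_time [set n | (m < n)%N /\ G < v n]) c.

Definition next_b (a : option nat) : option nat :=
  obind (fun m => inf_time [set n | (m <= n)%N /\ (v n <= G \/ 2 * G < v n)]) a.

Definition next_c (b : option nat) : option nat :=
  obind (fun m => inf_time [set n | (m <= n)%N /\ v n <= G]) b.

Fixpoint phase_c (i : nat) : option nat :=
  if i is j.+1 then next_c (next_b (next_a (phase_c j))) else Some 0%N.

(* The phase times a_i and b_i are only used for i >= 1. *)
Definition phase_a (i : nat) : option nat := next_a (phase_c i.-1).

Definition phase_b (i : nat) : option nat := next_b (phase_a i).

End phase_times.

(* The family (X i), i in I, satisfies
   sup_(i in I) E[|X i|; |X i| > K] --> 0 as K --> +oo. *)
Definition uniformly_integrable d (T : measurableType d) (R : realType)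
    (P : probability T R) (I : set nat) (X : nat -> T -> R) :=
  (forall i, I i -> measurable_fun [set: T] (X i)) /\
  ereal_sup [set (\int[P]_(w in [set w | (K < `|X i w|)%R]) `|X i w|%:E)%E
            | i in I] @[K --> +oo%R] --> 0%E.

Section condexp_facts.
Local Open Scope ereal_scope.
Context d (T : measurableType d) (R : realType) (P : probability T R).
Variable H : set (set T).
Hypothesis subH : sub_sigma_algebra_of H.

Let TH := g_sigma_algebraType H.

Let HE : @measurable _ TH = H.
Proof. by apply: measurable_g_measurableTypeE; case: subH. Qed.

Let idH : T -> TH := id.

Let midH : measurable_fun [set: T] idH.
Proof. by move=> _ B; rewrite setTI HE => HB; case: subH => _; exact. Qed.

HB.instance Definition _ := isMeasurableFun.Build _ _ _ _ idH midH.

Let PH : probability TH R := distribution P idH.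

Lemma measurable_wrt_measurable_fun d' (U : sigmaRingType d') (f : T -> U) :
  measurable_wrt H f -> measurable_fun [set: T] f.
Proof.
by move=> mf _ B mB; apply: subH.2; rewrite -HE; exact: mf.
Qed.

Let integral_PH A (Z : T -> \bar R) : H A -> measurable_wrt H Z ->
  P.-integrable setT Z -> \int[PH]_(w in A) Z w = \int[P]_(w in A) Z w.
Proof.
move=> HA mZ iZ; have mA := subH.2 _ HA.
have HA' : @measurable _ TH A by rewrite HE.
rewrite (integral_pushforward midH mZ)//.
exact: (integrableS measurableT).
Qed.

Lemma is_condexp_integrable (X : T -> R) Z :
  P.-integrable setT (EFin \o X) -> is_condexp P H X Z -> P.-integrable setT Z.
Proof.
move=> iX [mZ ZX]; have mZT := measurable_wrt_measurable_fun mZ.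
apply/integrableP; split => //; apply/abse_integralP => //.
rewrite ZX; last by rewrite -HE; exact: measurableT.
rewrite ltey_eq abse_fin_num; apply/orP; left.
exact: integrable_fin_num.
Qed.

Lemma is_condexp_exists (X : T -> R) :
  P.-integrable setT (EFin \o X) -> exists Z, is_condexp P H X Z.
Proof.
move=> iX.
pose nu : {charge set T -> \bar R} := induced_charge iX.
have nuP : nu `<< P.
  apply/null_content_dominatesP => A mA PA0.
  apply: null_set_integral => //; last exact: measurable_funTS (measurable_int _ iX).
have @nuH : {charge set TH -> \bar R} by exact: (pushforward nu idH).
have nuPH : nuH `<< PH := dominates_pushforward midH nuP.
pose Z : T -> \bar R := Radon_Nikodym nuH PH.
have iZ : PH.-integrable [set: TH] Z := Radon_Nikodym_integrable nuPH.
have mZ : measurable_wrt H Z := measurable_int _ iZ.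
have iZP : P.-integrable [set: T] Z.
  apply/integrableP; split; first exact: measurable_wrt_measurable_fun mZ.
  case/integrableP : iZ => _; rewrite ge0_integral_pushforward//.
  exact: measurableT_comp.
exists Z; split=> // A HA; rewrite -integral_PH//.
by rewrite -Radon_Nikodym_integral// HE.
Qed.

Lemma condexpP (X : T -> R) :
  P.-integrable setT (EFin \o X) -> is_condexp P H X 'E_P[X | H].
Proof. by move=> /is_condexp_exists; exact: xgetPex. Qed.

Lemma is_condexp_ae_unique (X : T -> R) Z1 Z2 :
  P.-integrable setT (EFin \o X) -> is_condexp P H X Z1 ->
  is_condexp P H X Z2 -> {ae P, forall w, Z1 w = Z2 w}.
Proof.
move=> iX c1 c2.
have i1 := is_condexp_integrable iX c1; have i2 := is_condexp_integrable iX c2.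
case: c1 c2 => [m1 c1] [m2 c2].
have iH1 : PH.-integrable [set: TH] Z1.
  by apply: integrable_pushforward.
have : ae_eq PH setT Z1 Z2.
  apply: integral_ae_eq => // E _; rewrite HE => HE'.
  by rewrite !integral_PH// c1// c2.
case=> N [mN N0 sub]; exists N; split => //.
  by apply: subH.2; rewrite -HE.
by move=> w /= nw; apply: sub => /= /(_ I).
Qed.

End condexp_facts.

(* Main.v *)
Require Import Defs.
From HB Require Import structures.
From mathcomp Require Import all_boot all_order all_algebra.
From mathcomp Require Import finmap.
From mathcomp Require Import all_classical all_reals all_analysis.
From mathcomp Require Import measurable_realfun.
From mathcomp Require Import ring lra.

Set Implicit Arguments.
Unset Strict Implicit.
Unset Printing Implicit Defensive.

Import Order.TTheory GRing.Theory Num.Theory.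
Import numFieldNormedType.Exports.

Local Open Scope classical_set_scope.
Local Open Scope ring_scope.

(** Only excursions above the level [G] matter, and only those that climb from
    the entrance height [BG < 2 * G] through the band up to [2 * G]: elsewhere
    [Y <= V <= 2 * G].

    The number of such climbs has finite expectation. A climb has to gain
    [2 * G - BG] from residuals or from the martingale part. The former is
    Markov's inequality against the residual budgets; the latter is Chebyshev's
    inequality, and the conditional variance of the martingale part inside the
    band is bounded by residuals, since [V <= 2 * G] there. Rather than summing
    over phases and stopping times, the proof carries along the potential
    [a * L + b * W ^+ 2], where [L] and [W] sum the residuals and the martingale
    increments since the last entrance into the band; each climb consumes one
    unit of it, and its expected growth is within the budgets
    ([upcrossing_bound]).

    After a climb, [V] starts at most at [B2G]. Until [V] is back below [G], the
    drift inequality turns this value plus residuals into a bound on the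
    dissipated amount [D], so the expected sum of [D] over all high phases is
    finite because the expected number of climbs is ([dissipation_bound]).

    Finally, within a high phase [Y] exceeds its initial value by at most its
    variation, whose conditional expectation is bounded by [D] and residuals.
    Hence [Y] stays below [2 * G + B2G] plus the total variation over all high
    phases ([excursion_le]), a random variable with finite expectation; this
    bounds the expectation of the running maxima uniformly, and the rest follows
    from monotone and dominated convergence.

    The phase times are replaced by the states of an automaton ([phase]), which
    makes the events of being in a given phase predictable by construction;
    [phase_historyP] relates the states to the times. *)

(** * Expectations of real random variables *)

Section real_expectation.
Context d (T : measurableType d) (R : realType) (P : probability T R).
Implicit Types (X Y f g : T -> R) (A : set T).

Local Notation intg X := (P.-integrable [set: T] (EFin \o X)).
Local Notation Ex X := (Rintegral P [set: T] X).

Lemma intg_measurable X : intg X -> measurable_fun [set: T] X.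
Proof. by move=> /measurable_int /measurable_EFinP. Qed.

Lemma intgD X Y : intg X -> intg Y -> intg (fun w => X w + Y w).
Proof. by move=> iX iY; exact: (integrableD measurableT iX iY). Qed.

Lemma intgB X Y : intg X -> intg Y -> intg (fun w => X w - Y w).
Proof. by move=> iX iY; exact: (integrableB measurableT iX iY). Qed.

Lemma intgZ c X : intg X -> intg (fun w => c * X w).
Proof. by move=> iX; exact: (integrableZl measurableT c iX). Qed.

Lemma intg_cst c : intg (fun=> c).
Proof. exact: finite_measure_integrable_cst. Qed.

Lemma intg_normr X : intg X -> intg (fun w => `|X w|).
Proof. exact: integrable_norm. Qed.

Lemma intg_sum (X : nat -> T -> R) N : (forall n, intg (X n)) ->
  intg (fun w => \sum_(n < N) X n w).
Proof.
move=> iX; elim: N => [|N IH].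
  by under eq_fun do rewrite big_ord0; exact: intg_cst.
by under eq_fun do rewrite big_ord_recr; exact: intgD.
Qed.

Lemma ae_le_intg f g : measurable_fun [set: T] f -> intg g ->
  {ae P, forall w, `|f w| <= g w} -> intg f.
Proof.
move=> mf ig fg; have /integrableP[mg goo] := ig.
have mf' : measurable_fun [set: T] (EFin \o f) by exact/measurable_EFinP.
apply/integrableP; split => //; apply: le_lt_trans goo.
apply: ae_ge0_le_integral => //.
- exact: measurableT_comp.
- exact: measurableT_comp.
by apply: filterS fg => w fgw _ /=; rewrite lee_fin (le_trans fgw)// ler_norm.
Qed.

Lemma le_intg f g : measurable_fun [set: T] f -> intg g ->
  (forall w, `|f w| <= g w) -> intg f.
Proof. by move=> mf ig fg; apply: ae_le_intg ig _ => //; exact: aeW. Qed.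

Lemma intg_indic A X : measurable A -> intg X -> intg (fun w => \1_A w * X w).
Proof.
move=> mA iX; apply: (le_intg _ (intg_normr iX)).
  by apply: measurable_funM => //; exact: intg_measurable.
move=> w; rewrite normrM indicE; case: (w \in A) => /=.
  by rewrite normr1 mul1r.
by rewrite normr0 mul0r.
Qed.

Lemma EFin_Ex X : intg X -> (Ex X)%:E = (\int[P]_w (X w)%:E)%E.
Proof. by move=> iX; rewrite fineK//; exact: integrable_fin_num. Qed.

Lemma ExD X Y : intg X -> intg Y -> Ex (fun w => X w + Y w) = Ex X + Ex Y.
Proof. exact: RintegralD. Qed.

Lemma ExZ c X : intg X -> Ex (fun w => c * X w) = c * Ex X.
Proof. by move=> iX; exact: RintegralZl. Qed.

Lemma Ex_cst c : Ex (fun=> c) = c.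
Proof.
rewrite Rintegral_cst// -[RHS]mulr1; congr (c * _).
exact: (congr1 fine (probability_setT P)).
Qed.

Lemma Ex_sum (X : nat -> T -> R) N : (forall n, intg (X n)) ->
  Ex (fun w => \sum_(n < N) X n w) = \sum_(n < N) Ex (X n).
Proof.
move=> iX; elim: N => [|N IH].
  by rewrite big_ord0; under eq_fun do rewrite big_ord0; exact: Ex_cst.
rewrite big_ord_recr /= -IH -ExD//; last exact: intg_sum.
by under eq_fun do rewrite big_ord_recr.
Qed.

Lemma Ex_ge0 X : (forall w, 0 <= X w) -> 0 <= Ex X.
Proof. by move=> X0; exact: Rintegral_ge0. Qed.

Lemma ae_eq_Ex X Y : intg X -> intg Y -> {ae P, forall w, X w = Y w} ->
  Ex X = Ex Y.
Proof.
move=> iX iY XY; congr fine; apply: ae_eq_integral => //.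
- exact: measurable_int iX.
- exact: measurable_int iY.
by apply: filterS XY => w -> _.
Qed.

(** [Y] is almost everywhere equal to [max X Y], which dominates [X]
    everywhere. *)
Lemma ae_le_Ex X Y : intg X -> intg Y -> {ae P, forall w, X w <= Y w} ->
  Ex X <= Ex Y.
Proof.
move=> iX iY XY.
have iM : intg (fun w => Num.max (X w) (Y w)).
  apply: (le_intg _ (intgD (intg_normr iX) (intg_normr iY))).
    by apply: measurable_maxr; exact: intg_measurable.
  move=> w /=; case: (leP (X w) (Y w)) => _.
    by rewrite lerDr normr_ge0.
  by rewrite lerDl normr_ge0.
rewrite [leRHS](ae_eq_Ex iY iM); last first.
  by apply: filterS XY => w; rewrite maxEle => ->.
by apply: le_Rintegral => // w _; rewrite le_max lexx.
Qed.

Lemma intg_mul X Y : measurable_fun [set: T] X -> measurable_fun [set: T] Y ->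
  intg (fun w => X w ^+ 2) -> intg (fun w => Y w ^+ 2) ->
  intg (fun w => X w * Y w).
Proof.
move=> mX mY iX iY; apply: (le_intg _ (intgD iX iY)).
  exact: measurable_funM.
move=> w; rewrite normrM -[X w ^+ 2]real_normK ?num_real//.
rewrite -[Y w ^+ 2]real_normK ?num_real//.
have := normr_ge0 (X w); have := normr_ge0 (Y w).
move: `|X w| `|Y w| => a b; nra.
Qed.

Lemma intg_sqrD X Y : measurable_fun [set: T] X -> measurable_fun [set: T] Y ->
  intg (fun w => X w ^+ 2) -> intg (fun w => Y w ^+ 2) ->
  intg (fun w => (X w + Y w) ^+ 2).
Proof.
move=> mX mY iX iY.
have := intgD (intgD iX iY) (intgZ 2 (intg_mul mX mY iX iY)).
by congr integrable; apply/funext => w /=; congr EFin; ring.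
Qed.

Lemma intg_of_sqr X : measurable_fun [set: T] X ->
  intg (fun w => X w ^+ 2) -> intg X.
Proof.
move=> mX iX; apply: (le_intg mX (intgD iX (intg_cst 1))) => w.
rewrite -[X w ^+ 2]real_normK ?num_real//.
have := normr_ge0 (X w); move: `|X w| => a; nra.
Qed.

Lemma Ex_indic_subset A A' X : measurable A -> measurable A' -> A `<=` A' ->
  (forall w, 0 <= X w) -> intg X ->
  Ex (fun w => \1_A w * X w) <= Ex (fun w => \1_A' w * X w).
Proof.
move=> mA mA' AA' X0 iX.
apply: ae_le_Ex; [exact: intg_indic|exact: intg_indic|].
apply: aeW => w; apply: ler_wpM2r => //; rewrite !indicE.
case: (boolP (w \in A)) => [/set_mem/AA' wA'|_]; last by rewrite ler0n.
by rewrite mem_set.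
Qed.

End real_expectation.

(** * Conditional expectation and orthogonality *)

Section conditional_expectation.
Context d (T : measurableType d) (R : realType) (P : probability T R).
Variable H : set (set T).
Hypothesis subH : sub_sigma_algebra_of H.
Implicit Types (X Y Z : T -> R) (A B : set T).

Local Notation intg X := (P.-integrable [set: T] (EFin \o X)).
Local Notation Ex X := (Rintegral P [set: T] X).
Local Notation TH := (g_sigma_algebraType H).

Lemma sub_measurableE : @measurable _ TH = H.
Proof. by apply: measurable_g_measurableTypeE; case: subH. Qed.

Lemma sub_measurable A : H A -> measurable A.
Proof. exact: subH.2. Qed.

Lemma sub_setT : H [set: T].
Proof. by rewrite -sub_measurableE; exact: (@measurableT _ TH). Qed.

Lemma sub_setI A B : H A -> H B -> H (A `&` B).
Proof. by rewrite -sub_measurableE; exact: (@measurableI _ TH). Qed.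

Lemma sub_setU A B : H A -> H B -> H (A `|` B).
Proof. by rewrite -sub_measurableE; exact: (@measurableU _ TH). Qed.

Lemma sub_setC A : H A -> H (~` A).
Proof. by rewrite -sub_measurableE; exact: (@measurableC _ TH). Qed.

Lemma sub_preimage d' (U : measurableType d') (f : T -> U) (B : set U) :
  measurable_wrt H f -> measurable B -> H (f @^-1` B).
Proof.
move=> mf mB; rewrite -sub_measurableE -[X in measurable X]setTI.
exact: (mf (@measurableT _ TH)).
Qed.

Lemma wrt_indic A : H A -> measurable_wrt H (\1_A : T -> R).
Proof.
move=> HA; apply: (@measurable_indic _ TH).
by rewrite sub_measurableE.
Qed.

(** For integrable [X] the conditional expectation is almost everywhere finite;
    passing to a real-valued version keeps infinite values out of the
    computations. *)
Definition rcondexp X : T -> R := fun w => fine (('E_P[X | H])%E w).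

Section integrable_argument.
Variable X : T -> R.
Hypothesis iX : intg X.

Let icondexp : P.-integrable [set: T] 'E_P[X | H]%E.
Proof. by apply: (is_condexp_integrable subH iX); exact: (condexpP subH). Qed.

Lemma ae_rcondexp : {ae P, forall w, ('E_P[X | H])%E w = (rcondexp X w)%:E}.
Proof.
have := integrable_ae measurableT icondexp.
by apply: filterS => w /(_ Logic.I) ?; rewrite fineK.
Qed.

Lemma intg_rcondexp : intg (rcondexp X).
Proof.
have mZ : measurable_fun [set: T] (rcondexp X).
  apply: (measurableT_comp (fine_measurable _))=> //.
  exact: measurable_int icondexp.
have /integrableP[m1 foo] := icondexp.
apply/integrableP; split; first exact/measurable_EFinP.
apply: le_lt_trans foo; apply: ae_ge0_le_integral => //.
- by apply: measurableT_comp => //; exact/measurable_EFinP.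
- exact: measurableT_comp.
by apply: filterS ae_rcondexp => w -> _.
Qed.

Lemma Ex_rcondexp A : H A ->
  Ex (fun w => \1_A w * rcondexp X w) = Ex (fun w => \1_A w * X w).
Proof.
move=> HA; have mA := sub_measurable HA.
have [_ /(_ A HA)] := condexpP subH iX.
rewrite integral_mkcond [RHS]integral_mkcond => E; congr fine.
have indE (f : T -> \bar R) w : (f \_ A) w = ((\1_A w)%:E * f w)%E.
  by rewrite patchE indicE; case: ifPn => _; rewrite ?mul1e ?mul0e.
transitivity (\int[P]_w (('E_P[X | H])%E \_ A) w)%E.
  apply: ae_eq_integral => //.
  - exact: measurable_int (intg_indic mA intg_rcondexp).
  - apply/(measurable_restrictT _ mA).
    by apply: measurable_funTS; exact: measurable_int icondexp.
  by apply: filterS ae_rcondexp => w E' _; rewrite indE E'.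
by rewrite E; apply: eq_integral => w _; rewrite indE.
Qed.

(** The event [A] that the conditional expectation is negative is itself
    [H]-measurable, so the integrals of [X] and of its conditional expectation
    over [A] agree; one is nonnegative and the other nonpositive, hence the
    conditional expectation vanishes almost everywhere on [A], that is, [A] is
    negligible. *)
Lemma rcondexp_ge0 : (forall w, 0 <= X w) ->
  {ae P, forall w, 0 <= rcondexp X w}.
Proof.
move=> X0; pose A := ('E_P[X | H])%E @^-1` [set y | (y < 0)%E].
have HA : H A.
  apply: sub_preimage; first by have [] := condexpP subH iX.
  have -> : [set y | (y < 0)%E] = `]-oo, (0 : \bar R)%E[%classic.
    by apply/seteqP; split=> y /=; rewrite in_itv.
  exact: emeasurable_itv.
pose Z w := \1_A w * rcondexp X w.
have iZ : intg Z by apply: intg_indic intg_rcondexp; exact: sub_measurable.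
have Z0 : {ae P, forall w, Z w <= 0}.
  apply: filterS ae_rcondexp => w E; rewrite /Z indicE.
  case: (boolP (w \in A)) => [|_]; last by rewrite mul0r.
  by rewrite inE /A /= E lte_fin mul1r => /ltW.
have EZ : Ex (fun w => `|Z w|) = 0.
  have EZX : Ex (fun w => `|Z w|) = - Ex (fun w => \1_A w * X w).
    rewrite -Ex_rcondexp// -mulN1r -ExZ//.
    apply: ae_eq_Ex; [exact: intg_normr|exact: intgZ|].
    by apply: filterS Z0 => w Zw; rewrite ler0_norm// mulN1r.
  apply/eqP; rewrite eq_le (Ex_ge0 _ (fun w => normr_ge0 _)) andbT.
  by rewrite EZX oppr_le0; apply: Ex_ge0 => w; rewrite mulr_ge0.
have : (\int[P]_w `|(Z w)%:E| = 0)%E.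
  by have := EFin_Ex (intg_normr iZ); rewrite EZ => <-.
move/(ae_eq_integral_abs P measurableT (measurable_int _ iZ)).
have := ae_rcondexp; apply: filterS2 => w E /(_ Logic.I).
rewrite /Z => -[]; rewrite indicE.
case: (boolP (w \in A)) => wA.
  by rewrite mul1r => ->.
move=> _; rewrite leNgt; apply/negP => lt0; move/negP: wA; apply.
by rewrite inE /A /= E lte_fin.
Qed.

End integrable_argument.

(** This is the only way in which the conditional hypotheses (quadratic
    variation, target variation) enter the proof: localized to an [H]-measurable
    event, a conditional bound becomes a bound between plain expectations. *)
Lemma Ex_rcondexp_le A X Z Y1 Y2 (c0 c1 c2 : R) :
  intg X -> intg Z -> intg Y1 -> intg Y2 -> H A ->
  {ae P, forall w, A w ->
    rcondexp X w <= c0 * Z w + c1 * rcondexp Y1 w + c2 * rcondexp Y2 w} ->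
  Ex (fun w => \1_A w * X w) <= c0 * Ex (fun w => \1_A w * Z w)
    + c1 * Ex (fun w => \1_A w * Y1 w) + c2 * Ex (fun w => \1_A w * Y2 w).
Proof.
move=> iX iZ iY1 iY2 HA XY; have mA := sub_measurable HA.
rewrite -(Ex_rcondexp iX HA) -(Ex_rcondexp iY1 HA) -(Ex_rcondexp iY2 HA).
have iA U : intg U -> intg (fun w => \1_A w * rcondexp U w).
  by move=> iU; exact/intg_indic/intg_rcondexp.
have i0 := intgZ c0 (intg_indic mA iZ).
have i1 := intgZ c1 (iA _ iY1); have i2 := intgZ c2 (iA _ iY2).
have i01 := intgD i0 i1; have i012 := intgD i01 i2.
rewrite -ExZ; last exact: intg_indic.
rewrite -ExZ; last exact: iA.
rewrite -ExZ; last exact: iA.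
rewrite -ExD// -ExD//.
apply: ae_le_Ex; [exact: iA|exact: i012|].
apply: filterS XY => w XY; rewrite indicE.
case: (boolP (w \in A)) => [|_]; last by rewrite !mul0r !mulr0 !addr0.
by rewrite inE !mul1r.
Qed.

Import HBNNSimple.

Lemma Ex_orthogonal_nnsfun (g : {nnsfun TH >-> R}) M : intg M ->
  (forall A, H A -> Ex (fun w => \1_A w * M w) = 0) ->
  Ex (fun w => g w * M w) = 0.
Proof.
move=> iM M0.
pose y (i : nat) := (fset_set (range g))`_i.
have Hg i : H (g @^-1` [set y i]).
  have : @measurable _ TH (g @^-1` [set y i]) by exact: measurable_sfunP.
  by move: (g @^-1` _) => B; rewrite sub_measurableE.
have gE w : g w * M w = \sum_(i < #|` fset_set (range g)|)
    y i * (\1_(g @^-1` [set y i]) w * M w).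
  by rewrite fimfunEord big_distrl /=; apply: eq_bigr => i _; rewrite mulrA.
have iy i : intg (fun w => y i * (\1_(g @^-1` [set y i]) w * M w)).
  by apply/intgZ/intg_indic => //; exact: sub_measurable.
pose f i w := y i * (\1_(g @^-1` [set y i]) w * M w).
transitivity (Ex (fun w => \sum_(i < #|` fset_set (range g)|) f i w)).
  by congr Rintegral; exact/funext.
rewrite (Ex_sum _ iy) big1// => i _.
rewrite ExZ ?M0 ?mulr0//.
by apply: intg_indic => //; exact: sub_measurable.
Qed.

(** The dyadic approximations of [X] are [H]-simple functions below [X], so
    [|X M|] dominates all the products and the identity passes to the limit. *)
Lemma Ex_orthogonal_ge0 X M : measurable_wrt H X -> (forall w, 0 <= X w) ->
  intg M -> intg (fun w => X w * M w) ->
  (forall A, H A -> Ex (fun w => \1_A w * M w) = 0) ->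
  Ex (fun w => X w * M w) = 0.
Proof.
move=> mX X0 iM iXM M0.
have mEX : @measurable_fun _ _ TH _ [set: TH] (EFin \o X).
  exact: (@measurableT_comp _ _ _ TH).
have EX0 (w : TH) : [set: TH] w -> (0 <= (EFin \o X) w)%E by rewrite lee_fin.
pose g := nnsfun_approx (@measurableT _ TH) mEX.
have gMX n w : `|g n w * M w| <= `|X w * M w|.
  rewrite !normrM ler_wpM2r// (ger0_norm (X0 w)) ger0_norm//.
  rewrite -lee_fin nnsfun_approxE.
  exact: (le_approx _ EX0).
have mgM n : measurable_fun [set: T] (fun w => (g n w * M w)%:E).
  apply/measurable_EFinP; apply: measurable_funM; last exact: intg_measurable iM.
  by apply: (measurable_wrt_measurable_fun subH); exact: measurable_funPT.
have g0 n : (\int[P]_w (g n w * M w)%:E)%E = 0%E.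
  rewrite -EFin_Ex ?Ex_orthogonal_nnsfun//.
  apply: (le_intg _ (intg_normr iXM)) => //.
  by have := mgM n => /measurable_EFinP.
have gX w : (g n w * M w)%:E @[n --> \oo] --> (X w * M w)%:E.
  rewrite EFinM; under eq_fun do rewrite EFinM.
  apply: cvgeZr => //; first exact: (cvg_nnsfun_approx _ _ EX0).
have [//||_ _] := dominated_convergence measurableT mgM
  (measurable_int _ iXM) _ (intg_normr iXM) _.
- by apply: aeW => w _; exact: gX.
- by apply: aeW => w n _ /=; rewrite lee_fin gMX.
under eq_fun do rewrite g0.
move/(cvg_lim (@ereal_hausdorff R)) => E.
by rewrite /Rintegral -E lim_cst.
Qed.

(** A martingale increment is orthogonal to the past. This makes the cross term
    of a squared martingale disappear; there [X] is a sum of earlier increments,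
    hence unbounded and of either sign. *)
Lemma Ex_orthogonal X M : measurable_wrt H X -> intg M ->
  intg (fun w => X w * M w) ->
  (forall A, H A -> Ex (fun w => \1_A w * M w) = 0) ->
  Ex (fun w => X w * M w) = 0.
Proof.
move=> mX iM iXM M0.
have mp : measurable_wrt H X^\+ by exact: (@measurable_funrpos _ TH).
have mn : measurable_wrt H X^\- by exact: (@measurable_funrneg _ TH).
have mXT := measurable_wrt_measurable_fun subH.
have XE w : X w * M w = X^\+ w * M w + -1 * (X^\- w * M w).
  have /(congr1 (fun f => f w)) := funrposBneg X.
  by rewrite /= !fctE => <-; ring.
have part Z : measurable_wrt H Z -> (forall w, 0 <= Z w <= `|X w|) ->
    intg (fun w => Z w * M w) /\ Ex (fun w => Z w * M w) = 0.
  move=> mZ ZX; have iZM : intg (fun w => Z w * M w).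
    apply: (le_intg _ (intg_normr iXM)).
      by apply: measurable_funM; [exact: mXT|exact: intg_measurable iM].
    move=> w; have /andP[Z0 ?] := ZX w.
    by rewrite !normrM ler_wpM2r// ger0_norm.
  by split=> //; apply: Ex_orthogonal_ge0 => // w; case/andP: (ZX w).
have [ip p0] : intg (fun w => X^\+ w * M w) /\ Ex (fun w => X^\+ w * M w) = 0.
  apply: part => // w; rewrite funrpos_ge0 /funrpos /= ge_max ler_norm.
  exact: normr_ge0.
have [iN n0] : intg (fun w => X^\- w * M w) /\ Ex (fun w => X^\- w * M w) = 0.
  apply: part => // w; rewrite funrneg_ge0 /funrneg /= ge_max -normrN ler_norm.
  exact: normr_ge0.
transitivity (Ex (fun w => X^\+ w * M w + -1 * (X^\- w * M w))).
  by congr Rintegral; exact/funext.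
by rewrite ExD ?ExZ ?p0 ?n0 ?mulr0 ?addr0//; exact: intgZ.
Qed.

End conditional_expectation.

(** * Phase times as an automaton *)

Section phases.
Variables (R : realType) (G : R) (v : nat -> R).

Lemma inf_time_eq (S : set nat) n : S n -> (forall k, (k < n)%N -> ~ S k) ->
  inf_time S = Some n.
Proof.
move=> Sn nS; rewrite /inf_time; case: pselect => [ex|[]]; last first.
  by exists n; apply/asboolP.
congr Some; case: ex_minnP => k /asboolP Sk kmin; apply/eqP.
rewrite eqn_leq kmin ?andTb; last exact/asboolP.
by rewrite leqNgt; apply/negP => /nS.
Qed.

(** The phase times as a finite automaton reading [v 1, v 2, ...]: [None] between
    some [c_i] and the next [a_(i+1)], [Some false] during [a_i <= n < b_i]
    (inside the band), [Some true] during [b_i <= n < c_i] (after leaving the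
    band through its top). Unlike the times, the state at [n] is visibly a
    function of [v 1, ..., v n]. A value above [2 * G] read in state [None] leads
    to [Some false]; this disagrees with the phase times, for which [a_i = b_i]
    then holds, and is excluded below by the hypothesis on the values at the
    times [a_i]. *)
Fixpoint phase n : option bool :=
  if n is m.+1 then
    if v n <= G then None
    else match phase m with
         | None => Some false
         | Some high => Some (high || (2 * G < v n))
         end
  else None.

Lemma phaseS n : phase n.+1 =
  if v n.+1 <= G then None
  else match phase n with
       | None => Some false
       | Some high => Some (high || (2 * G < v n.+1))
       end.
Proof. by []. Qed.

(** The invariant tying the automaton to the phase times: it names the phase time
    [m] at which the current state was entered. The index of [phase_c] counts
    the completed excursions. *)
Definition phase_history n : Prop :=
  match phase n with
  | None => exists i m, [/\ phase_c G v i = Some m, (m <= n)%N &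
      forall k, (m < k <= n)%N -> v k <= G]
  | Some false => exists i m, [/\ phase_a G v i.+1 = Some m, (m <= n)%N &
      forall k, (m <= k <= n)%N -> G < v k <= 2 * G]
  | Some true => exists i m, [/\ phase_b G v i.+1 = Some m, (m <= n)%N &
      forall k, (m <= k <= n)%N -> G < v k]
  end.

Lemma entrance_is_phase_a n : phase_history n -> phase n = None ->
  G < v n.+1 -> exists i, phase_a G v i.+1 = Some n.+1.
Proof.
rewrite /phase_history => /[swap] -> [i [m [ci mn low]]] vn; exists i.
rewrite /phase_a /= ci /=; apply: inf_time_eq => [|k kn [mk]].
  by split; rewrite ?ltnS.
by apply/negP; rewrite -leNgt; apply: low; rewrite mk -ltnS.
Qed.

Lemma exit_is_phase_b n : phase_history n -> phase n = Some false ->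
  (v n.+1 <= G \/ 2 * G < v n.+1) ->
  exists i, phase_b G v i.+1 = Some n.+1.
Proof.
rewrite /phase_history => /[swap] -> [i [m [ai mn band]]] vn; exists i.
rewrite /phase_b ai /=; apply: inf_time_eq => [|k kn [mk]].
  by split; rewrite // leqW.
have /andP[lo hi] : G < v k <= 2 * G by apply: band; rewrite mk -ltnS.
by case => [|]; apply/negP; rewrite -?leNgt -?ltNge.
Qed.

Hypothesis a_le : forall i n, phase_a G v i.+1 = Some n -> v n <= 2 * G.

Lemma phase_historyP n : phase_history n.
Proof.
elim: n => [|n IH].
  exists 0%N, 0%N; split => // k; by case: k.
rewrite {1}/phase_history /=; case: (leP (v n.+1) G) => vG.
  (* A value below the level closes the excursion in progress, if any: from the
     band it makes b_i and c_i coincide. *)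
  case E : (phase n) => [[|]|].
  - move: (IH); rewrite /phase_history E => -[i [m [bi mn high]]].
    exists i.+1, n.+1; split => //; last by move=> k; rewrite ltnNge andNb.
    rewrite /= -[next_b _ _ _]/(phase_b G v i.+1) bi /=.
    apply: inf_time_eq => [|k kn [mk]]; first by split => //; exact: leqW.
    by apply/negP; rewrite -ltNge; apply: high; rewrite mk -ltnS.
  - have [//|i bi] := exit_is_phase_b IH E; first by left.
    exists i.+1, n.+1; split => //; last by move=> k; rewrite ltnNge andNb.
    rewrite /= -[next_b _ _ _]/(phase_b G v i.+1) bi /=.
    by apply: inf_time_eq => [//|k kn [+ _]]; rewrite leqNgt kn.
  - move: (IH); rewrite /phase_history E => -[i [m [ci mn low]]].
    exists i, m; split => //; first exact: leqW.
    move=> k /andP[mk]; rewrite leq_eqVlt ltnS => /predU1P[->//|kn].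
    by apply: low; rewrite mk.
case E : (phase n) => [[|]|] /=.
- move: (IH); rewrite /phase_history E => -[i [m [bi mn high]]].
  exists i, m; split => //; first exact: leqW.
  move=> k /andP[mk]; rewrite leq_eqVlt ltnS => /predU1P[->//|kn].
  by apply: high; rewrite mk.
- case: (ltP (2 * G) (v n.+1)) => v2G.
    have [//|i bi] := exit_is_phase_b IH E; first by right.
    exists i, n.+1; split => // k.
    by rewrite -eqn_leq => /eqP <-.
  move: (IH); rewrite /phase_history E => -[i [m [ai mn band]]].
  exists i, m; split => //; first exact: leqW.
  move=> k /andP[mk]; rewrite leq_eqVlt ltnS => /predU1P[->|kn].
    by rewrite vG.
  by apply: band; rewrite mk.
- have [i ai] := entrance_is_phase_a IH E vG.
  exists i, n.+1; split => // k; rewrite -eqn_leq => /eqP <-.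
  by rewrite vG (a_le ai).
Qed.

Lemma phase_low_le n : phase n.+1 = None -> v n.+1 <= G.
Proof. by rewrite /=; case: ifP => //; case: (phase n). Qed.

Lemma phase_above n b : phase n = Some b -> G < v n.
Proof. by case: n => [|n] //=; case: (leP (v n.+1) G). Qed.

Lemma band_le n : phase n = Some false -> v n <= 2 * G.
Proof.
move=> E; have := phase_historyP n; rewrite /phase_history E.
by move=> [i [m [_ mn /(_ n)]]]; rewrite mn leqnn => /(_ isT) /andP[].
Qed.

Lemma phase_entrance n : phase n.+1 = Some false -> phase n <> Some false ->
  exists i, phase_a G v i.+1 = Some n.+1.
Proof.
move=> BS Bn; apply: entrance_is_phase_a; first exact: phase_historyP.
  move: BS Bn; rewrite phaseS; case: ifP => // _.
  by case: (phase n) => [[|]|].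
exact: phase_above BS.
Qed.

Lemma phase_exit n : phase n = Some false -> phase n.+1 = Some true ->
  2 * G < v n.+1.
Proof. by rewrite phaseS => ->; case: ifP => // _ []. Qed.

Lemma phase_exit_phase_b n : phase n = Some false -> phase n.+1 = Some true ->
  exists i, phase_b G v i.+1 = Some n.+1.
Proof.
move=> Bn HS; apply: exit_is_phase_b => //; first exact: phase_historyP.
by right; exact: phase_exit.
Qed.

Lemma high_from_band n : phase n.+1 = Some true -> phase n <> Some true ->
  phase n = Some false.
Proof.
rewrite phaseS; case: ifP => // _.
by case: (phase n) => [[|]|].
Qed.

End phases.

(** * Counting upcrossings of the band *)

Section upcrossings.
Context d (T : measurableType d) (R : realType) (P : probability T R).
Variable F : nat -> set (set T).
Hypothesis HF : filtration F.

Local Notation intg X := (P.-integrable [set: T] (EFin \o X)).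
Local Notation Ex X := (Rintegral P [set: T] X).

Lemma measurable_wrt_le m n d' (U : measurableType d') (f : T -> U) :
  (m <= n)%N -> measurable_wrt (F m) f -> measurable_wrt (F n) f.
Proof.
move=> mn mf _ B mB; rewrite setTI (sub_measurableE (HF.1 n)).
by apply: (HF.2 m n mn); exact: (sub_preimage (HF.1 m)).
Qed.

(** In the following, [B n] is the event that [v] travels through the band
    between [lo] and [hi] at time [n], and [K n] the event that the step from [n]
    to [n.+1] leaves the band through its top. *)
Variables (v r m : nat -> T -> R) (B K : nat -> set T) (lo hi : R).
Hypothesis lo_hi : lo < hi.
Hypothesis drift : forall n, {ae P, forall w, v n.+1 w <= v n w + r n w + m n w}.
Hypothesis r_ge0 : forall n w, 0 <= r n w.
Hypothesis ir : forall n, intg (r n).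
Hypothesis mm : forall n, measurable_wrt (F n.+1) (m n).
Hypothesis im2 : forall n, intg (fun w => m n w ^+ 2).
Hypothesis m_orth : forall n A, F n A -> Ex (fun w => \1_A w * m n w) = 0.
Hypothesis FB : forall n, F n (B n).
Hypothesis mK : forall n, measurable (K n).
Hypothesis enter0 : {ae P, forall w, B 0%N w -> v 0%N w <= lo}.
Hypothesis enterS : forall n, {ae P, forall w,
  B n.+1 w -> ~ B n w -> v n.+1 w <= lo}.
Hypothesis KB : forall n, K n `<=` B n.
Hypothesis KBS : forall n w, K n w -> ~ B n.+1 w.
Hypothesis exit_hi : forall n w, K n w -> hi < v n.+1 w.

Let subF n : sub_sigma_algebra_of (F n) := HF.1 n.

Let mB n : measurable (B n). Proof. by apply: (sub_measurable (subF n)). Qed.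

(** The sum of [x] since the start of the current stay in [B], and [0] outside
    [B]. The recursion restarts at every entrance, which replaces a sum between
    two random times. *)
Fixpoint sojourn_sum (x : nat -> T -> R) n : T -> R :=
  if n is k.+1 then
    fun w => \1_(B k.+1) w * (sojourn_sum x k w + \1_(B k) w * x k w)
  else fun=> 0.

Let L := sojourn_sum r.
Let W := sojourn_sum m.

Let intg_L n : intg (L n).
Proof.
elim: n => [|n IH]; first exact: intg_cst.
by apply: intg_indic => //; apply: intgD => //; exact: intg_indic.
Qed.

Let L_ge0 n w : 0 <= L n w.
Proof. by elim: n => //= n IH; rewrite mulr_ge0// addr_ge0// mulr_ge0. Qed.

Let mW n : measurable_wrt (F n) (W n).
Proof.
elim: n => [|n IH] /=.
  exact: (@measurable_cst _ _ (g_sigma_algebraType (F 0%N))).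
have h1 : measurable_wrt (F n.+1) (\1_(B n.+1) : T -> R) by exact: wrt_indic.
have h2 : measurable_wrt (F n.+1) (\1_(B n) : T -> R).
  by apply: (measurable_wrt_le (leqnSn n)); exact: wrt_indic.
have h3 := measurable_wrt_le (leqnSn n) IH.
apply: (@measurable_funM _ (g_sigma_algebraType (F n.+1))) => //.
apply: (@measurable_funD _ (g_sigma_algebraType (F n.+1))) => //.
apply: (@measurable_funM _ (g_sigma_algebraType (F n.+1))) => //.
exact: mm.
Qed.

Let sqr_indic A (X : T -> R) w : (\1_A w * X w) ^+ 2 = \1_A w * X w ^+ 2.
Proof.
by rewrite indicE; case: (w \in A); rewrite ?mul1r// !mul0r expr0n.
Qed.

Let mBm n : measurable_fun [set: T] (fun w => \1_(B n) w * m n w).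
Proof.
apply: measurable_funM => //.
exact: (measurable_wrt_measurable_fun (subF n.+1)).
Qed.

Let iBm2 n : intg (fun w => (\1_(B n) w * m n w) ^+ 2).
Proof.
under eq_fun do rewrite sqr_indic.
exact: intg_indic.
Qed.

Let mWT n : measurable_fun [set: T] (W n).
Proof. exact: (measurable_wrt_measurable_fun (subF n)). Qed.

Let intg_W2 n : intg (fun w => W n w ^+ 2).
Proof.
elim: n => [|n IH].
  by under eq_fun do rewrite expr0n; exact: intg_cst.
pose Z w := W n w + \1_(B n) w * m n w.
have := intg_indic (mB n.+1) (intg_sqrD (mWT n) (mBm n) IH (iBm2 n)).
congr integrable; apply/funext => w; congr EFin.
exact/esym/(sqr_indic _ Z).
Qed.

(** Every stay starts below [lo], and from there on the drift inequality adds
    up. *)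
Let pathwise : {ae P, forall w, forall n, B n w -> v n w <= lo + L n w + W n w}.
Proof.
have := ae_foralln drift; have := ae_foralln enterS; move: enter0.
apply: filterS3 => w e0 eS dr; elim=> [|n IH] BS.
  by rewrite /= !addr0; exact: e0.
have [Bn|Bn] := pselect (B n w).
  have := IH Bn; have := dr n; rewrite /L /W /= !indicE !mem_set//.
  by rewrite !mul1r; lra.
rewrite (le_trans (eS _ BS Bn))//.
have out x : sojourn_sum x n.+1 w = 0.
  rewrite /= !indicE (memNset Bn) mul0r addr0.
  by case: (n) Bn => [|k] Bk /=; rewrite ?mulr0// indicE (memNset Bk) mul0r mulr0.
by rewrite /L /W !out !addr0.
Qed.

(** Climbing from [lo] to [hi] takes a total of at least [hi - lo] from [L] and
    [W] together, so at least half of it from one of them; the two alternatives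
    are paid for as in the inequalities of Markov and of Chebyshev. *)
Let a := 2 / (hi - lo).
Let b := 4 / (hi - lo) ^+ 2.

Let a_ge0 : 0 <= a. Proof. by rewrite divr_ge0// subr_ge0 ltW. Qed.
Let b_ge0 : 0 <= b. Proof. by rewrite divr_ge0// sqr_ge0. Qed.

Let exit_cost (x y : R) : 0 <= x -> hi - lo <= x + y -> 1 <= a * x + b * y ^+ 2.
Proof.
move=> x0 xy; have d0 : 0 < hi - lo by rewrite subr_gt0.
rewrite /a /b; set dl := hi - lo in d0 xy *.
have -> : 2 / dl * x + 4 / dl ^+ 2 * y ^+ 2 = 2 * (x / dl) + (2 * (y / dl)) ^+ 2.
  by field; rewrite gt_eqF.
have : 1 <= x / dl + y / dl by rewrite -mulrDl ler_pdivlMr// mul1r.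
have : 0 <= x / dl by rewrite divr_ge0// ltW.
move: (x / dl) (y / dl) => s t; nra.
Qed.

(** The potential: the payment already collected for the next crossing. It is
    cashed in at a crossing and merely forgotten when the stay ends without
    one. *)
Let Phi n w := a * L n w + b * W n w ^+ 2.

Let potential_step n : {ae P, forall w, Phi n.+1 w + \1_(K n) w <=
  Phi n w + (a * (\1_(B n) w * r n w) + b * (\1_(B n) w * m n w ^+ 2)
    + 2 * b * ((W n w * \1_(B n) w) * m n w))}.
Proof.
move: (pathwise) (drift n); apply: filterS2 => w pw dr.
rewrite -sqr_indic (_ : Phi n w + _ = a * (L n w + \1_(B n) w * r n w)
  + b * (W n w + \1_(B n) w * m n w) ^+ 2); last by rewrite /Phi; ring.
set x := L n w + _; set y := W n w + _.
have x0 : 0 <= x by rewrite addr_ge0// mulr_ge0.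
have rhs0 : 0 <= a * x + b * y ^+ 2 by rewrite addr_ge0// mulr_ge0// sqr_ge0.
have [BS|BS] := pselect (B n.+1 w).
  have Kn : ~ K n w by move/KBS.
  by rewrite /Phi /L /W /= !indicE (memNset Kn) (mem_set BS) !mul1r addr0.
rewrite /Phi /L /W /= !(indicE _ (B n.+1)) (memNset BS) !mul0r expr0n !mulr0 !add0r.
rewrite indicE; case: (boolP (w \in K n)) => // /set_mem Kn.
apply: exit_cost => //; have Bn := KB Kn.
move: (exit_hi Kn) (pw _ Bn) dr; rewrite /x /y indicE mem_set// !mul1r /=.
lra.
Qed.

(** The expected number of crossings is controlled by what is put into the
    potential. Conditioning on the past, the square [(W + m)^2] only grows by
    [m^2], since the cross term is a martingale increment against [W]. *)
Lemma upcrossing_bound N :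
  \sum_(n < N) Ex (\1_(K n)) <= \sum_(n < N)
    (2 / (hi - lo) * Ex (fun w => \1_(B n) w * r n w)
     + 4 / (hi - lo) ^+ 2 * Ex (fun w => \1_(B n) w * m n w ^+ 2)).
Proof.
have iPhi n : intg (Phi n) by apply: intgD; apply: intgZ.
have iK n : intg (\1_(K n)) by exact: integrable_indic.
have iWm n : intg (fun w => (W n w * \1_(B n) w) * m n w).
  under eq_fun do rewrite -mulrA.
  exact: intg_mul.
have Wm0 n : Ex (fun w => (W n w * \1_(B n) w) * m n w) = 0.
  apply: (Ex_orthogonal (X := fun w => W n w * \1_(B n) w) (subF n)) => //;
    last exact: m_orth.
    apply: (@measurable_funM _ (g_sigma_algebraType (F n))); first exact: mW.
    exact: wrt_indic.
  apply: intg_of_sqr => //.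
  exact: (measurable_wrt_measurable_fun (subF n.+1)).
have step n : Ex (Phi n.+1) + Ex (\1_(K n)) <= Ex (Phi n)
    + (a * Ex (fun w => \1_(B n) w * r n w)
       + b * Ex (fun w => \1_(B n) w * m n w ^+ 2)).
  have iBr : intg (fun w => \1_(B n) w * r n w) by exact: intg_indic.
  have iBm : intg (fun w => \1_(B n) w * m n w ^+ 2) by exact: intg_indic.
  have j1 := intgZ a iBr; have j2 := intgZ b iBm.
  have j3 := intgZ (2 * b) (iWm n).
  have j12 := intgD j1 j2; have j123 := intgD j12 j3.
  rewrite -ExD// -(ExZ a iBr) -(ExZ b iBm) -ExD//.
  rewrite -[X in Ex (Phi n) + X]addr0 -(mulr0 (2 * b)) -(Wm0 n) -(ExZ (2 * b))//.
  rewrite -ExD// -ExD//.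
  apply: ae_le_Ex; [exact: intgD|exact: intgD|exact: potential_step].
suff : Ex (Phi N) + \sum_(n < N) Ex (\1_(K n)) <= \sum_(n < N)
    (a * Ex (fun w => \1_(B n) w * r n w)
     + b * Ex (fun w => \1_(B n) w * m n w ^+ 2)).
  apply: le_trans; rewrite lerDr; apply: Ex_ge0 => w.
  by rewrite addr_ge0// mulr_ge0// sqr_ge0.
elim: N => [|N IH].
  rewrite !big_ord0 addr0 (_ : Phi 0%N = fun=> 0) ?Ex_cst//.
  by apply/funext => w; rewrite /Phi /L /W /= expr0n !mulr0 addr0.
by rewrite !big_ord_recr /=; move: (step N) IH; lra.
Qed.

End upcrossings.

(** * Running supremum and uniform integrability *)

Section running_supremum.
Context d (T : measurableType d) (R : realType) (P : probability T R).
Variable Y : nat -> T -> R.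
Hypothesis mY : forall n, (1 <= n)%N -> measurable_fun [set: T] (Y n).
Hypothesis Y_ge0 : forall n, (1 <= n)%N -> forall w, 0 <= Y n w.

Local Notation intg X := (P.-integrable [set: T] (EFin \o X)).
Local Notation Ex X := (Rintegral P [set: T] X).

Let supY w : \bar R := ereal_sup [set (Y n w)%:E | n in [set n | (1 <= n)%N]].
Let maxY N w := \big[Num.max/Y 1%N w]_(1 <= n < N.+1) Y n w.

Let maxY_ge n N w : (1 <= n <= N)%N -> Y n w <= maxY N w.
Proof.
move=> /andP[n1 nN]; apply: (@le_bigmax_seq _ _ _ _ _ n xpredT (Y^~ w)) => //.
by rewrite mem_index_iota n1.
Qed.

Let maxY_le N w (c : R) : Y 1%N w <= c ->
  (forall n, (1 <= n <= N)%N -> Y n w <= c) -> maxY N w <= c.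
Proof.
move=> Y1 Yc; by rewrite /maxY big_nat; exact: bigmax_le.
Qed.

Let maxY_nd w : {homo maxY^~ w : m n / (m <= n)%N >-> m <= n}.
Proof. by move=> m n mn; apply: le_bigmax_nat; rewrite ?ltnS. Qed.

Let maxY_ge0 N w : 0 <= maxY N w.
Proof.
apply: (le_trans (Y_ge0 (ltnSn 0) w)).
by rewrite /maxY; exact: bigmax_ge_id.
Qed.

Let mmaxY N : measurable_fun [set: T] (maxY N).
Proof.
rewrite /maxY; have : {in index_iota 1 N.+1, forall n, (1 <= n)%N}.
  by move=> n; rewrite mem_index_iota => /andP[].
elim: (index_iota 1 N.+1) => [|n s IH] s1.
  by under eq_fun do rewrite big_nil; exact: mY.
under eq_fun do rewrite big_cons.
apply: measurable_maxr; first by apply: mY; apply: s1; rewrite mem_head.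
by apply: IH => k ks; apply: s1; rewrite inE ks orbT.
Qed.

Let supY_cvg w : (maxY n.+1 w)%:E @[n --> \oo] --> supY w.
Proof.
have Y_sup n : (1 <= n)%N -> ((Y n w)%:E <= supY w)%E.
  by move=> n1; apply: ereal_sup_ubound; exists n.
have -> : supY w = ereal_sup (range (fun n => (maxY n.+1 w)%:E)).
  apply/eqP; rewrite eq_le; apply/andP; split; apply: ge_ereal_sup.
    move=> _ [n /= n1 <-]; apply: le_ereal_sup_tmp.
    exists (maxY n.-1.+1 w)%:E; first by exists n.-1.
    by rewrite prednK// lee_fin maxY_ge// n1 leqnn.
  move=> _ [n _ <-].
  rewrite /maxY /=; have : {in index_iota 1 n.+2, forall k, (1 <= k)%N}.
    by move=> k; rewrite mem_index_iota => /andP[].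
  elim: (index_iota 1 n.+2) => [|k s IH] s1; first by rewrite big_nil Y_sup.
  rewrite big_cons EFin_max ge_max IH ?andbT; last first.
    by move=> j js; apply: s1; rewrite inE js orbT.
  by apply: Y_sup; apply: s1; rewrite mem_head.
apply: (@ereal_nondecreasing_cvgn R (fun n => (maxY n.+1 w)%:E)) => m n mn.
by rewrite lee_fin; exact: maxY_nd.
Qed.

Let supY_ge0 w : (0 <= supY w)%E.
Proof.
apply: (@le_trans _ _ (Y 1%N w)%:E); first by rewrite lee_fin Y_ge0.
by apply: ereal_sup_ubound; exists 1%N.
Qed.

Let msupY : measurable_fun [set: T] supY.
Proof.
apply: (@emeasurable_fun_cvg _ _ _ _ (fun n w => (maxY n.+1 w)%:E)).
  by move=> n; exact/measurable_EFinP.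
by move=> w _; exact: supY_cvg.
Qed.

Lemma integral_sup_eq : (\int[P]_w supY w)%E =
  ereal_sup [set ('E_P[maxY N])%E | N in [set N | (1 <= N)%N]].
Proof.
have nd (w : T) : [set: T] w ->
    {homo (fun n => (maxY n.+1 w)%:E) : m n / (m <= n)%N >-> (m <= n)%E}.
  by move=> _ m n mn; rewrite lee_fin; exact: maxY_nd.
have mE n : measurable_fun [set: T] (fun w => (maxY n.+1 w)%:E).
  exact/measurable_EFinP.
have ge0 n (w : T) : [set: T] w -> (0 <= (maxY n.+1 w)%:E)%E.
  by rewrite lee_fin.
transitivity (\int[P]_w limn (fun n => (maxY n.+1 w)%:E))%E.
  by apply: eq_integral => w _; apply/esym/cvg_lim => //; exact: supY_cvg.
rewrite (monotone_convergence P measurableT mE ge0 nd).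
have : nondecreasing_seq (fun n => \int[P]_w (maxY n.+1 w)%:E)%E.
  move=> m n mn; apply: ge0_le_integral => //.
    exact: ge0.
  by move=> w _; exact: nd.
move/ereal_nondecreasing_cvgn/cvg_lim => -> //.
congr ereal_sup; apply/seteqP; split=> x.
  by move=> [n _ <-]; exists n.+1 => //=; rewrite unlock.
by move=> [[//|n] _ <-]; exists n => //=; rewrite unlock.
Qed.

Lemma integral_sup_le (X : nat -> T -> R) (c C : R) :
  (forall n, intg (X n)) -> (forall n w, 0 <= X n w) ->
  {ae P, forall w, forall n, (1 <= n)%N -> Y n w <= c + \sum_(k < n) X k w} ->
  (forall N, \sum_(k < N) Ex (X k) <= C) ->
  (\int[P]_w supY w <= (c + C)%:E)%E.
Proof.
move=> iX X0 YX XC; rewrite integral_sup_eq.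
apply: ge_ereal_sup => _ [N /= N1 <-]; rewrite unlock.
have iS := intgD (intg_cst P c) (intg_sum N iX).
have le : {ae P, forall w, maxY N w <= c + \sum_(k < N) X k w}.
  apply: filterS YX => w YX.
  have nd n : (1 <= n <= N)%N -> Y n w <= c + \sum_(k < N) X k w.
    move=> /andP[n1 nN]; rewrite (le_trans (YX _ n1))// lerD2l.
    rewrite -!(big_mkord xpredT (X^~ w)) [leRHS](big_cat_nat (leq0n n) nN)/=.
    by rewrite lerDl sumr_ge0.
  by apply: maxY_le => //; apply: nd; rewrite N1.
have iM : intg (maxY N).
  apply: (ae_le_intg _ iS) => //.
  by apply: filterS le => w; rewrite ger0_norm.
rewrite -EFin_Ex// lee_fin (le_trans (ae_le_Ex iM iS le))//.
by rewrite ExD ?Ex_cst ?Ex_sum ?lerD2l//; [exact: intg_cst|exact: intg_sum].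
Qed.

Hypothesis supY_lty : (\int[P]_w supY w < +oo)%E.

Let isupY : P.-integrable [set: T] supY.
Proof.
apply/integrableP; split => //.
by under eq_integral do rewrite gee0_abs//.
Qed.

Lemma ae_sup_lty : {ae P, forall w, (supY w < +oo)%E}.
Proof.
apply: filterS (integrable_ae measurableT isupY) => w /(_ Logic.I).
by rewrite ge0_fin_numE.
Qed.

(** The supremum is an integrable majorant of the whole family, so its tails
    dominate all the tails of the family at once. *)
Let tail (K : R) := (\int[P]_(w in [set w | (K%:E < supY w)%E]) supY w)%E.

Let mtail K : measurable [set w | (K%:E < supY w)%E].
Proof. by rewrite -[X in measurable X]setTI; exact: emeasurable_fun_o_infty. Qed.

Let tail_cvg0 : tail K @[K --> +oo] --> 0%E.
Proof.
apply/cvge_pinftyP => u uoo.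
pose f n := supY \_ [set w | ((u n)%:E < supY w)%E].
have -> : (fun n => tail (u n)) = fun n => (\int[P]_w f n w)%E.
  by apply/funext => n; rewrite /tail integral_mkcond.
have [|||||_ _] := @dominated_convergence _ _ _ P _ measurableT f (cst 0%E) supY.
- by move=> n; apply/(measurable_restrictT _ (mtail _)); exact: measurable_funTS.
- exact: measurable_cst.
- apply: filterS ae_sup_lty => w wlt _.
  apply: cvg_near_cst.
  have /cvgryPge/(_ (fine (supY w))) := uoo.
  apply: filterS => n un; rewrite /f patchE memNset//=.
  by apply/negP; rewrite -leNgt -(@fineK _ (supY w)) ?ge0_fin_numE ?lee_fin.
- exact: isupY.
- apply: aeW => w n _; rewrite /f patchE.
  by case: ifP => _; rewrite ?gee0_abs// abse0.
by rewrite integral_cst// mul0e.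
Qed.

Lemma dominated_uniformly_integrable :
  uniformly_integrable P [set n | (1 <= n)%N] Y.
Proof.
split; first by move=> n /= n1; exact: mY.
apply: (@squeeze_cvge _ _ _ _ (cst 0%E) _ tail); last 2 first.
- exact: cvg_cst.
- exact: tail_cvg0.
apply: nearW => K; apply/andP; split.
  apply: le_ereal_sup_tmp; eexists; first by exists 1%N.
  exact: integral_ge0.
apply: ge_ereal_sup => _ [n /= n1 <-].
have Yle w : (`|Y n w|%:E <= supY w)%E.
  by rewrite ger0_norm ?Y_ge0//; apply: ereal_sup_ubound; exists n.
have mYn : measurable_fun [set: T] (fun w => `|Y n w|%:E).
  by apply/measurable_EFinP; apply: measurableT_comp => //; exact: mY.
have mA : measurable [set w | K < `|Y n w|].
  rewrite (_ : [set w | _] = [set w | (K%:E < `|Y n w|%:E)%E])//.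
  by rewrite -[X in measurable X]setTI; exact: emeasurable_fun_o_infty.
apply: (@le_trans _ _ (\int[P]_(w in [set w | (K < `|Y n w|)%R]) supY w)%E).
  apply: ge0_le_integral => //.
  - exact: measurable_funTS.
  - exact: measurable_funTS.
apply: ge0_subset_integral => //; first exact: measurable_funTS.
by move=> w /= Kw; rewrite (lt_le_trans _ (Yle w))// lte_fin.
Qed.

End running_supremum.

(** * Excursions above the band *)

(** Outside the excursions [y] is at most [a]; inside, it exceeds its value at the
    start of the excursion, at most [b], by no more than its variation there. *)
Lemma excursion_le (R : realType) (y : nat -> R) (h : pred nat) (a b : R) :
  0 <= a -> 0 <= b -> ~~ h 0%N ->
  (forall n, ~~ h n -> y n <= a) ->
  (forall n, h n.+1 -> ~~ h n -> y n.+1 <= b) ->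
  forall n, y n <= a + b + \sum_(k < n) (h k)%:R * `|y k.+1 - y k|.
Proof.
move=> a0 b0 h0 ya yb.
have sum0 n : 0 <= \sum_(k < n) (h k)%:R * `|y k.+1 - y k|.
  by apply: sumr_ge0 => k _; rewrite mulr_ge0.
have inside n : h n -> y n <= b + \sum_(k < n) (h k)%:R * `|y k.+1 - y k|.
  elim: n => [|n IH] hn; first by rewrite hn in h0.
  have [hn'|hn'] := boolP (h n); last by rewrite (le_trans (yb _ hn hn'))// lerDl.
  rewrite big_ord_recr /= hn' mul1r.
  have := IH hn'; have := ler_norm (y n.+1 - y n); lra.
move=> n; have [hn|hn] := boolP (h n).
  by rewrite (le_trans (inside _ hn))// -addrA lerDr.
by rewrite (le_trans (ya _ hn))// -addrA lerDl addr_ge0.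
Qed.

Section dissipation.
Context d (T : measurableType d) (R : realType) (P : probability T R).

Local Notation intg X := (P.-integrable [set: T] (EFin \o X)).
Local Notation Ex X := (Rintegral P [set: T] X).

(** Here [H n] is the event of being in the phase that starts above the band, at
    most at the height [top], and [K n] the event that this phase starts at time
    [n.+1]. *)
Variables (v D r m : nat -> T -> R) (H K : nat -> set T) (cD top : R).
Hypothesis v_ge0 : forall n w, 0 <= v n w.
Hypothesis drift : forall n, {ae P, forall w,
  v n.+1 w + cD * D n w <= v n w + r n w + m n w}.
Hypothesis iv : forall n, intg (v n).
Hypothesis iD : forall n, intg (D n).
Hypothesis ir : forall n, intg (r n).
Hypothesis im : forall n, intg (m n).
Hypothesis mH : forall n, measurable (H n).
Hypothesis mK : forall n, measurable (K n).
Hypothesis m_orth : forall n, Ex (fun w => \1_(H n) w * m n w) = 0.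
Hypothesis H0 : H 0%N = set0.
Hypothesis HK : forall n w, H n.+1 w -> ~ H n w -> K n w.
Hypothesis K_top : forall n, {ae P, forall w, K n w -> v n.+1 w <= top}.
Hypothesis top_ge0 : 0 <= top.

(** The value of [v] at the start of a high phase finances all the dissipation
    until its end, up to residuals: the localized process [\1_(H n) * v n]
    telescopes except at the crossings, each of which contributes at most
    [top]. *)
Lemma dissipation_bound N :
  cD * \sum_(n < N) Ex (fun w => \1_(H n) w * D n w) <=
  \sum_(n < N) (Ex (fun w => \1_(H n) w * r n w) + top * Ex (\1_(K n))).
Proof.
have iHv n : intg (fun w => \1_(H n) w * v n w) by exact: intg_indic.
have iHD n : intg (fun w => \1_(H n) w * D n w) by exact: intg_indic.
have iHr n : intg (fun w => \1_(H n) w * r n w) by exact: intg_indic.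
have iHm n : intg (fun w => \1_(H n) w * m n w) by exact: intg_indic.
have iK n : intg (\1_(K n)) by exact: integrable_indic.
have step n : Ex (fun w => \1_(H n.+1) w * v n.+1 w)
      + cD * Ex (fun w => \1_(H n) w * D n w) <=
    Ex (fun w => \1_(H n) w * v n w)
      + (Ex (fun w => \1_(H n) w * r n w) + top * Ex (\1_(K n))).
  have iL := intgD (iHv n.+1) (intgZ cD (iHD n)).
  have iRK := intgD (iHr n) (intgZ top (iK n)).
  rewrite -(ExZ cD (iHD n)) -(ExZ top (iK n)) -(ExD (iHv n.+1) (intgZ cD (iHD n))).
  rewrite -(ExD (iHr n) (intgZ top (iK n))) -[X in _ <= _ + X]addr0 -(m_orth n).
  rewrite -(ExD iRK (iHm n)) -(ExD (iHv n) (intgD iRK (iHm n))).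
  apply: ae_le_Ex => //; first exact: (intgD (iHv n) (intgD iRK (iHm n))).
  move: (drift n) (K_top n); apply: filterS2 => w dr Kt.
  have K0 : 0 <= top * (\1_(K n) w : R) by rewrite mulr_ge0.
  have [Hn|Hn] := pselect (H n w).
    have : \1_(H n.+1) w * v n.+1 w <= v n.+1 w.
      by rewrite ler_piMl// indicE; case: (_ \in _).
    by rewrite !(indicE _ (H n)) (mem_set Hn) !mul1r; lra.
  rewrite !(indicE _ (H n)) (memNset Hn) !mul0r mulr0 !add0r !addr0.
  have [HS|HS] := pselect (H n.+1 w); last by rewrite indicE memNset// mul0r.
  have Kn := HK HS Hn.
  by rewrite !indicE (mem_set HS) (mem_set Kn) mul1r mulr1; exact: Kt.
suff : Ex (fun w => \1_(H N) w * v N w)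
    + cD * \sum_(n < N) Ex (fun w => \1_(H n) w * D n w) <=
    \sum_(n < N) (Ex (fun w => \1_(H n) w * r n w) + top * Ex (\1_(K n))).
  by apply: le_trans; rewrite lerDr; apply: Ex_ge0 => w; rewrite mulr_ge0.
elim: N => [|N IH].
  rewrite !big_ord0 mulr0 addr0 H0.
  by under eq_fun do rewrite indic0 mul0r; rewrite Ex_cst.
by rewrite !big_ord_recr /=; move: (step N) IH; lra.
Qed.

End dissipation.

Section phase_sets.
Context d (T : measurableType d) (R : realType).
Variables (F : nat -> set (set T)) (V : nat -> T -> R) (G : R).
Hypothesis HF : filtration F.
Hypothesis mV : forall n, measurable_wrt (F n) (V n.+1).

Definition in_phase b n : set T := [set w | phase G (V ^~ w) n.+1 = Some b].

(** The two states have to be treated together, since each of them at time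
    [n.+1] depends on both at time [n]. *)
Lemma sub_in_phase n : F n (in_phase false n) /\ F n (in_phase true n).
Proof.
have gtF k c : F k [set w | c < V k.+1 w].
  have -> : [set w | c < V k.+1 w] = V k.+1 @^-1` `]c, +oo[%classic.
    by apply/seteqP; split=> w /=; rewrite in_itv/= andbT.
  by apply: (sub_preimage (HF.1 k)).
have leF k c : F k [set w | V k.+1 w <= c].
  have -> : [set w | V k.+1 w <= c] = ~` [set w | c < V k.+1 w].
    by apply/seteqP; split=> w /=; rewrite leNgt => /negP.
  exact: (sub_setC (HF.1 k)).
elim: n => [|n [IHb IHh]].
  split.
    have -> : in_phase false 0 = [set w | G < V 1%N w] by
      apply/seteqP; split=> w; rewrite /in_phase /=; case: leP.
    exact: gtF.
  have -> : in_phase true 0 = set0.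
    by apply/seteqP; split=> w //; rewrite /in_phase /=; case: leP.
  by rewrite -setCT; apply: (sub_setC (HF.1 0%N)); exact: (sub_setT (HF.1 0%N)).
have up A : F n A -> F n.+1 A by exact: (HF.2 n n.+1 (leqnSn n)).
have [sI sU] := (sub_setI (HF.1 n.+1), sub_setU (HF.1 n.+1)).
split.
  have -> : in_phase false n.+1 = [set w | G < V n.+2 w] `&`
      (~` (in_phase false n `|` in_phase true n) `|`
       in_phase false n `&` [set w | V n.+2 w <= 2 * G]).
    apply/seteqP; split=> w; rewrite /in_phase.
      rewrite /setU /setI /setC /mkset (phaseS _ _ n.+1);
      case: (leP (V n.+2 w) G) => //.
      case: (phase _ _ n.+1) => [[|]|] //= Gv.
        by case: ltP => // v2 _; split => //; right.
      by move=> _; split => //; left => -[].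
    rewrite /setU /setI /setC /mkset (phaseS _ _ n.+1) => -[Gv];
      rewrite [_ <= G]leNgt Gv.
    case: (phase _ _ n.+1) => [[|]|] //=.
      by move=> [nh|[]//]; case: nh; right.
    move=> [nh|[_]]; first by case: nh; left.
    by rewrite leNgt => /negbTE ->.
  apply/sI; first exact: gtF.
  apply/sU; last by apply/sI; [exact: up|exact: leF].
  by apply: (sub_setC (HF.1 n.+1)); apply/sU; exact: up.
have -> : in_phase true n.+1 = [set w | G < V n.+2 w] `&`
    (in_phase true n `|` in_phase false n `&` [set w | 2 * G < V n.+2 w]).
  apply/seteqP; split=> w; rewrite /in_phase.
    rewrite /setU /setI /setC /mkset (phaseS _ _ n.+1);
      case: (leP (V n.+2 w) G) => //.
    case: (phase _ _ n.+1) => [[|]|] //= Gv.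
      by move=> _; split => //; left.
    by case: ltP => // v2 _; split => //; right.
  rewrite /setU /setI /setC /mkset (phaseS _ _ n.+1) => -[Gv];
      rewrite [_ <= G]leNgt Gv.
  case: (phase _ _ n.+1) => [[|]|] //=; first by move=> [//|[_ ->]].
  by move=> [|[]].
apply/sI; first exact: gtF.
apply/sU; first exact: up.
by apply/sI; [exact: up|exact: gtF].
Qed.

End phase_sets.

(** * Finiteness of the expected supremum *)

Lemma partial_sums_bounded (R : realType) (u : nat -> \bar R) :
  (forall n, (1 <= n)%N -> (0 <= u n)%E) ->
  (\sum_(1 <= n <oo) u n < +oo)%E ->
  exists C : R, forall N, (\sum_(k < N) u k.+1 <= C%:E)%E.
Proof.
move=> u0 ulty.
have u0' n : (1 <= n)%N -> xpredT n -> (0 <= u n)%E by move=> /u0.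
exists (fine (\sum_(1 <= n <oo) u n)%E) => N.
rewrite fineK; last by rewrite ge0_fin_numE//; exact: nneseries_ge0.
apply: le_trans (nneseries_lim_ge N.+1 u0').
by rewrite big_add1 /= big_mkord.
Qed.

(** The budget hypotheses are sums from [1] on of extended expectations; the
    processes below are indexed from [0], so that the [n]-th one is measurable
    with respect to [F n]. *)
Lemma budget_bounded d (T : measurableType d) (R : realType)
    (P : probability T R) (A : nat -> set T) (Z : nat -> T -> R) :
  (forall n, measurable (A n.+1)) ->
  (forall n, (1 <= n)%N -> forall w, 0 <= Z n w) ->
  (forall n, (1 <= n)%N -> P.-integrable [set: T] (EFin \o Z n)) ->
  (\sum_(1 <= n <oo) 'E_P[fun w => (\1_(A n) w * Z n w)%R] < +oo)%E ->
  exists C : R, forall N,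
    \sum_(k < N) Rintegral P [set: T] (fun w => \1_(A k.+1) w * Z k.+1 w) <= C.
Proof.
move=> mA Z0 iZ /partial_sums_bounded[|C HC].
  move=> n n1; rewrite unlock; apply: integral_ge0 => w _.
  by rewrite lee_fin mulr_ge0// Z0.
exists C => N; rewrite -lee_fin -sumEFin; apply: le_trans (HC N).
apply: lee_sum => k _; rewrite unlock EFin_Ex//.
exact: (intg_indic (mA k) (iZ _ (ltn0Sn k))).
Qed.

Local Open Scope ereal_scope.

Theorem theorem2 (d : measure_display) (T : measurableType d) (R : realType)
  (P : probability T R) (F : nat -> set (set T)) (HF : filtration F)
  (V Y D Rn Rt M : nat -> T -> R)
  (cD cR cH G BG B2G k0 k1 k2 k3 CYD CYR CYH : R)
  (V_ge0 : forall n, (1 <= n)%N -> forall w, (0 <= V n w)%R)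
  (Y_ge0 : forall n, (1 <= n)%N -> forall w, (0 <= Y n w)%R)
  (mV : forall n, (1 <= n)%N -> measurable_wrt (F n.-1) (V n))
  (mY : forall n, (1 <= n)%N -> measurable_wrt (F n.-1) (Y n))
  (Y_le_V : forall n, (1 <= n)%N -> {ae P, forall w, (Y n w <= V n w)%R})
  (cD_gt0 : (0 < cD)%R) (cR_gt0 : (0 < cR)%R) (cH_gt0 : (0 < cH)%R)
  (drift : forall n, (1 <= n)%N -> {ae P, forall w,
    (V n.+1 w - V n w <= - cD * D n w + cR * Rn n w + cH * Rt n w + M n w)%R})
  (D_ge0 : forall n, (1 <= n)%N -> forall w, (0 <= D n w)%R)
  (mD : forall n, (1 <= n)%N -> measurable_wrt (F n.-1) (D n))
  (Rn_ge0 : forall n, (1 <= n)%N -> forall w, (0 <= Rn n w)%R)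
  (Rt_ge0 : forall n, (1 <= n)%N -> forall w, (0 <= Rt n w)%R)
  (mRn : forall n, (1 <= n)%N -> measurable_wrt (F n) (Rn n))
  (mRt : forall n, (1 <= n)%N -> measurable_wrt (F n) (Rt n))
  (iRn : forall n, (1 <= n)%N -> P.-integrable setT (EFin \o Rn n))
  (iRt : forall n, (1 <= n)%N -> P.-integrable setT (EFin \o Rt n))
  (mM : forall n, (1 <= n)%N -> measurable_wrt (F n) (M n))
  (M_sq : forall n, (1 <= n)%N ->
    P.-integrable setT (fun w => (M n w ^+ 2)%:E))
  (M_mds : forall n, (1 <= n)%N ->
    {ae P, forall w, 'E_P[M n | F n.-1] w = 0})
  (G_gt0 : (0 < G)%R)
  (V1_le_G : {ae P, forall w, (V 1%N w <= G)%R})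
  (BG_gt0 : (0 < BG)%R) (B2G_gt0 : (0 < B2G)%R) (BG_lt : (BG < 2 * G)%R)
  (k0_ge0 : (0 <= k0)%R) (k1_ge0 : (0 <= k1)%R)
  (k2_ge0 : (0 <= k2)%R) (k3_ge0 : (0 <= k3)%R)
  (cross_a : forall i, (1 <= i)%N -> {ae P, forall w, forall n,
    phase_a G (V ^~ w) i = Some n -> (V n w <= BG)%R})
  (cross_b : forall i, (1 <= i)%N -> {ae P, forall w, forall n,
    phase_b G (V ^~ w) i = Some n -> (2 * G < V n w)%R -> (V n w <= B2G)%R})
  (budget_R :
    \sum_(1 <= n <oo)
      'E_P[fun w => (\1_[set x | (G < V n x)%R] w * Rn n w)%R] < +oo)
  (budget_Rt :
    \sum_(1 <= n <oo)
      'E_P[fun w => (\1_[set x | (G < V n x)%R] w * Rt n w)%R] < +oo)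
  (quad_var : forall n, (1 <= n)%N -> {ae P, forall w,
    (\1_[set x | (G < V n x <= 2 * G)%R] w)%:E
      * 'E_P[fun x => (M n x ^+ 2)%R | F n.-1] w
    <= (\1_[set x | (G < V n x <= 2 * G)%R] w)%:E
      * ((k0 + k1 * V n w + k2 * V n w ^+ 2)%:E * 'E_P[Rn n | F n.-1] w
         + k3%:E * 'E_P[Rt n | F n.-1] w)})
  (target_var : forall n, (1 <= n)%N -> {ae P, forall w,
    (\1_[set x | (G < V n x)%R] w)%:E
      * 'E_P[fun x => `|Y n.+1 x - Y n x|%R | F n.-1] w
    <= (\1_[set x | (G < V n x)%R] w)%:E
      * ((CYD * D n w)%:E + CYR%:E * 'E_P[Rn n | F n.-1] w
         + CYH%:E * 'E_P[Rt n | F n.-1] w)}) :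
  let supY w := ereal_sup [set (Y n w)%:E | n in [set n | (1 <= n)%N]] in
  let maxY N w := (\big[Num.max/Y 1%N w]_(1 <= n < N.+1) Y n w)%R in
  [/\ \int[P]_w supY w
        = ereal_sup [set 'E_P[maxY N] | N in [set N | (1 <= N)%N]],
      \int[P]_w supY w < +oo,
      {ae P, forall w, supY w < +oo}
    & uniformly_integrable P [set n | (1 <= n)%N] Y].
Proof.
move=> supY maxY.
pose Ex X := Rintegral P [set: T] X.
have subF := HF.1.
have mVT n : measurable_fun [set: T] (V n.+1).
  exact: (measurable_wrt_measurable_fun (subF n) (mV _ (ltn0Sn n))).
have mYT n : (1 <= n)%N -> measurable_fun [set: T] (Y n).
  case: n => // n _.
  exact: (measurable_wrt_measurable_fun (subF n) (mY _ (ltn0Sn n))).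
have mDT n : measurable_fun [set: T] (D n.+1).
  exact: (measurable_wrt_measurable_fun (subF n) (mD _ (ltn0Sn n))).
have mMT n : measurable_fun [set: T] (M n.+1).
  exact: (measurable_wrt_measurable_fun (subF n.+1) (mM _ (ltn0Sn n))).
have iM n : P.-integrable setT (EFin \o M n.+1).
  exact: (intg_of_sqr (mMT n) (M_sq _ (ltn0Sn n))).
pose r n w := (cR * Rn n.+1 w + cH * Rt n.+1 w)%R.
have r_ge0 n w : (0 <= r n w)%R.
  by rewrite addr_ge0// mulr_ge0 ?Rn_ge0 ?Rt_ge0// ltW.
have ir n : P.-integrable setT (EFin \o r n).
  by apply: intgD; apply: intgZ; [exact: iRn|exact: iRt].
have drift' n : {ae P, forall w,
    (V n.+2 w + cD * D n.+1 w <= V n.+1 w + r n w + M n.+1 w)%R}.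
  by apply: filterS (drift _ (ltn0Sn n)) => w; rewrite /r; lra.
have D0 n w : (0 <= cD * D n.+1 w)%R by rewrite mulr_ge0 ?D_ge0// ltW.
(* Integrability propagates forward: each value is nonnegative and at most the
   previous one plus integrable terms. In turn, nonnegativity of the next value
   bounds the dissipation. *)
have iV n : P.-integrable setT (EFin \o V n.+1).
  elim: n => [|n IH].
    apply: (ae_le_intg (mVT 0%N) (intg_cst P G)).
    by apply: filterS V1_le_G => w; rewrite ger0_norm ?V_ge0.
  apply: (ae_le_intg (mVT n.+1) (intgD (intgD IH (ir n)) (iM n))).
  apply: filterS (drift' n) => w; rewrite ger0_norm ?V_ge0//.
  by have := D0 n w; lra.
have iD n : P.-integrable setT (EFin \o D n.+1).
  have i := intgZ cD^-1 (intgD (intgD (iV n) (ir n)) (iM n)).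
  apply: (ae_le_intg (mDT n) i).
  apply: filterS (drift' n) => w dr; rewrite ger0_norm ?D_ge0//.
  rewrite mulrC ler_pdivlMr// mulrC.
  by have := V_ge0 _ (ltn0Sn n.+1) w; lra.
have iY n : P.-integrable setT (EFin \o Y n.+1).
  apply: (ae_le_intg (mYT n.+1 (ltn0Sn n)) (iV n)).
  by apply: filterS (Y_le_V _ (ltn0Sn n)) => w; rewrite ger0_norm ?Y_ge0.
have M_orth n A : F n A -> Ex (fun w => \1_A w * M n.+1 w)%R = 0%R.
  move=> FA; rewrite /Ex -(Ex_rcondexp (subF n) (iM n) FA).
  rewrite -[RHS](Ex_cst P 0); apply: ae_eq_Ex.
  - apply: intg_indic; first exact: (sub_measurable (subF n)).
    exact: (intg_rcondexp (subF n)).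
  - exact: intg_cst.
  apply: filterS (M_mds _ (ltn0Sn n)) => w; rewrite /rcondexp /= => ->.
  by rewrite mulr0.
have ae_a : {ae P, forall w, forall i n,
    phase_a G (V ^~ w) i.+1 = Some n -> (V n w <= BG)%R}.
  by apply/ae_foralln => i; exact: cross_a.
have ae_b : {ae P, forall w, forall i n,
    phase_b G (V ^~ w) i.+1 = Some n -> (2 * G < V n w)%R -> (V n w <= B2G)%R}.
  by apply/ae_foralln => i; exact: cross_b.
(* Almost surely every value at some a_i is below 2 * G, so the automaton
   follows the phase times. *)
have a_le : {ae P, forall w, forall i n,
    phase_a G (V ^~ w) i.+1 = Some n -> (V n w <= 2 * G)%R}.
  by apply: filterS ae_a => w a i n /a /le_trans; apply; exact: ltW.
pose B := in_phase V G false; pose Hi := in_phase V G true.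
have mV' n : measurable_wrt (F n) (V n.+1) by exact: (mV _ (ltn0Sn n)).
have FB n : F n (B n) by have [] := sub_in_phase G HF mV' n.
have FH n : F n (Hi n) by have [] := sub_in_phase G HF mV' n.
have mB n : measurable (B n) by exact: (sub_measurable (subF n)).
have mHi n : measurable (Hi n) by exact: (sub_measurable (subF n)).
pose K n := B n `&` Hi n.+1.
have mK n : measurable (K n) by exact: measurableI.
have B_band : {ae P, forall w, forall n, B n w -> (V n.+1 w <= 2 * G)%R}.
  by apply: filterS a_le => w a n; exact: band_le.
have enterS n : {ae P, forall w, B n.+1 w -> ~ B n w -> (V n.+2 w <= BG)%R}.
  move: ae_a a_le; apply: filterS2 => w a a2 BS Bn.
  by have [i] := phase_entrance a2 BS Bn; exact: a.
have enter0 : {ae P, forall w, B 0%N w -> (V 1%N w <= BG)%R}.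
  move: ae_a a_le; apply: filterS2 => w a a2 B0.
  by have [//|i] := phase_entrance a2 B0; exact: a.
have exit_hi n w : K n w -> (2 * G < V n.+2 w)%R.
  by move=> [Bn HS]; exact: phase_exit Bn HS.
have K_top n : {ae P, forall w, K n w -> (V n.+2 w <= B2G)%R}.
  move: ae_b a_le; apply: filterS2 => w b a2 Kn.
  have [i bi] := phase_exit_phase_b a2 Kn.1 Kn.2.
  exact: b bi (exit_hi _ _ Kn).
have HK n w : Hi n.+1 w -> ~ Hi n w -> K n w.
  by move=> HS Hn; split => //; exact: high_from_band HS Hn.
have KBS n w : K n w -> ~ B n.+1 w.
  by move=> [_]; rewrite /Hi /B /in_phase /mkset => ->.
have H0 : Hi 0%N = set0.
  apply/seteqP; split=> w //.
  by rewrite /Hi /in_phase /=; case: (leP (V 1%N w) G).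
(* Both kinds of phase lie above the level, where the residuals are budgeted. *)
pose U n := [set w | (G < V n.+1 w)%R].
have mU n : measurable (U n).
  rewrite /U -[X in measurable X]setTI; exact: measurable_fun_ltr.
have BU n : B n `<=` U n by move=> w; exact: phase_above.
have HU n : Hi n `<=` U n by move=> w; exact: phase_above.
have mU' n : measurable [set w | (G < V n.+1 w)%R] by exact: mU.
have [CR1 HR] := budget_bounded mU' Rn_ge0 iRn budget_R.
have [CT1 HT] := budget_bounded mU' Rt_ge0 iRt budget_Rt.
pose rho k := Ex (fun w => \1_(U k) w * Rn k.+1 w)%R.
pose tau k := Ex (fun w => \1_(U k) w * Rt k.+1 w)%R.
have iRn' n : P.-integrable setT (EFin \o Rn n.+1) by exact: iRn.
have iRt' n : P.-integrable setT (EFin \o Rt n.+1) by exact: iRt.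
have leR A n : A `<=` U n -> measurable A ->
    (Ex (fun w => \1_A w * Rn n.+1 w) <= rho n)%R.
  by move=> AU mA; apply: Ex_indic_subset => // w; exact: Rn_ge0.
have leT A n : A `<=` U n -> measurable A ->
    (Ex (fun w => \1_A w * Rt n.+1 w) <= tau n)%R.
  by move=> AU mA; apply: Ex_indic_subset => // w; exact: Rt_ge0.
have le_r A n : A `<=` U n -> measurable A ->
    (Ex (fun w => \1_A w * r n w) <= cR * rho n + cH * tau n)%R.
  move=> AU mA.
  have e : (fun w => \1_A w * r n w)%R = (fun w =>
      cR * (\1_A w * Rn n.+1 w) + cH * (\1_A w * Rt n.+1 w))%R.
    by apply/funext => w; rewrite /r; ring.
  have j1 := intg_indic mA (iRn' n); have j2 := intg_indic mA (iRt' n).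
  rewrite e /Ex (ExD (intgZ cR j1) (intgZ cH j2)) (ExZ cR j1) (ExZ cH j2).
  by apply: lerD; (apply: ler_wpM2l; first exact: ltW); [exact: leR|exact: leT].
(* On [B n] the value is at most 2 * G, which bounds the polynomial factor of
   the conditional variance. *)
pose kq := (k0 + k1 * (2 * G) + k2 * (2 * G) ^+ 2)%R.
have kq0 : (0 <= kq)%R by rewrite !addr_ge0// mulr_ge0// ?sqr_ge0// mulr_ge0// ltW.
have leM n : (Ex (fun w => \1_(B n) w * M n.+1 w ^+ 2)
    <= kq * rho n + k3 * tau n)%R.
  have iM2 : P.-integrable setT (EFin \o (fun w => M n.+1 w ^+ 2)%R).
    exact: M_sq.
  (* The summand with coefficient 0 is void: the bound on the conditional
     variance consists of conditional expectations only. *)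
  have := @Ex_rcondexp_le _ _ _ P _ (subF n) (B n) _ _ _ _ 0 kq k3
    iM2 (iRn' n) (iRn' n) (iRt' n) (FB n).
  rewrite mul0r add0r => /(_ _)/le_trans; apply; last first.
    by apply: lerD; apply: ler_wpM2l => //; [exact: leR|exact: leT].
  have q1 := ae_rcondexp (subF n) iM2.
  have q2 := ae_rcondexp (subF n) (iRn' n).
  have q3 := ae_rcondexp (subF n) (iRt' n).
  have q4 : {ae P, forall w, (0 <= rcondexp P (F n) (Rn n.+1) w)%R}.
    by apply: (rcondexp_ge0 (subF n) (iRn' n)) => w; exact: Rn_ge0.
  have q5 := quad_var _ (ltn0Sn n).
  apply: (filterS3 _ _ (filterI q1 q2) (filterI q3 q4) (filterI q5 B_band)).
  move=> w [e1 e2] [e3 R0] [qv band] Bn.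
  have v2 := band n Bn; have vG := BU _ _ Bn.
  move: qv; rewrite /= e1 e2 e3 indicE mem_set/=; last by rewrite vG v2.
  rewrite !mul1e -!EFinM -EFinD lee_fin mul0r add0r => /le_trans; apply.
  rewrite lerD2r; apply: ler_wpM2r => //; rewrite /kq.
  have v0 := V_ge0 _ (ltn0Sn n) w.
  rewrite -!addrA lerD2l; apply: lerD; first exact: ler_wpM2l.
  by apply: ler_wpM2l => //; apply: lerXn2r; rewrite ?nnegrE// (le_trans v0).
(* Here a and b are the weights of the potential that pays for the climbs. *)
have [CK HK1] : exists C : R, forall N, (\sum_(n < N) Ex (\1_(K n)) <= C)%R.
  have dl : (0 < 2 * G - BG)%R by rewrite subr_gt0.
  pose a := (2 / (2 * G - BG))%R; pose b := (4 / (2 * G - BG) ^+ 2)%R.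
  have a0 : (0 <= a)%R by rewrite divr_ge0// ltW.
  have b0 : (0 <= b)%R by rewrite divr_ge0// sqr_ge0.
  exists ((a * cR + b * kq) * CR1 + (a * cH + b * k3) * CT1)%R => N.
  have dr n : {ae P, forall w, (V n.+2 w <= V n.+1 w + r n w + M n.+1 w)%R}.
    by apply: filterS (drift' n) => w; have := D0 n w; lra.
  have mM' n : measurable_wrt (F n.+1) (M n.+1) by exact: mM.
  have iM2 n : P.-integrable setT (EFin \o (fun w => M n.+1 w ^+ 2)%R).
    exact: M_sq.
  apply: le_trans (@upcrossing_bound _ _ _ P F HF (fun n => V n.+1) r
    (fun n => M n.+1) B K BG (2 * G) BG_lt dr r_ge0 ir mM' iM2 M_orth FB mK
    enter0 enterS (fun n w Kn => Kn.1) KBS exit_hi N) _.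
  apply: (@le_trans _ _ (\sum_(n < N)
      ((a * cR + b * kq) * rho n + (a * cH + b * k3) * tau n))%R).
    apply: ler_sum => n _.
    have h1 := ler_wpM2l a0 (le_r _ _ (BU n) (mB n)).
    have h2 := ler_wpM2l b0 (leM n).
    rewrite [leRHS](_ : _ = a * (cR * rho n + cH * tau n)
      + b * (kq * rho n + k3 * tau n))%R; last by ring.
    exact: lerD h1 h2.
  rewrite big_split -!mulr_sumr; apply: lerD; apply: ler_wpM2l => //.
  - by apply: addr_ge0; apply: mulr_ge0 => //; exact: ltW.
  - by apply: addr_ge0; apply: mulr_ge0 => //; exact: ltW.
(* At most CK climbs are expected, each starting a high phase at B2G or
   below. *)
have [CD HD] : exists C : R, forall N,
    (\sum_(n < N) Ex (fun w => \1_(Hi n) w * D n.+1 w) <= C)%R.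
  exists ((cR * CR1 + cH * CT1 + B2G * CK) / cD)%R => N.
  rewrite ler_pdivlMr// mulrC.
  apply: le_trans (@dissipation_bound _ _ _ P (fun n => V n.+1)
    (fun n => D n.+1) r (fun n => M n.+1) Hi K cD B2G
    (fun n => V_ge0 _ (ltn0Sn n)) drift' iV iD ir iM mHi mK
    (fun n => M_orth n _ (FH n)) H0 HK K_top (ltW B2G_gt0) N) _.
  rewrite big_split -mulr_sumr; apply: lerD; last first.
    by apply: ler_wpM2l; [exact: ltW|exact: HK1].
  apply: (@le_trans _ _ (\sum_(n < N) (cR * rho n + cH * tau n))%R).
    by apply: ler_sum => n _; exact: le_r.
  rewrite big_split -!mulr_sumr.
  by apply: lerD; (apply: ler_wpM2l; first exact: ltW); [exact: HR|exact: HT].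
pose X k w := (\1_(Hi k) w * `|Y k.+2 w - Y k.+1 w|)%R.
have idY k : P.-integrable setT (EFin \o (fun w => `|Y k.+2 w - Y k.+1 w|)%R).
  exact/intg_normr/intgB.
have iX k : P.-integrable setT (EFin \o X k) by exact: intg_indic.
have X0 k w : (0 <= X k w)%R by rewrite mulr_ge0.
have HX N : (\sum_(k < N) Ex (X k) <=
    `|CYD| * CD + `|CYR| * CR1 + `|CYH| * CT1)%R.
  have leX n : (Ex (X n) <= `|CYD| * Ex (fun w => \1_(Hi n) w * D n.+1 w)
      + `|CYR| * rho n + `|CYH| * tau n)%R.
    have := @Ex_rcondexp_le _ _ _ P _ (subF n) (Hi n) _ _ _ _ CYD CYR CYH
      (idY n) (iD n) (iRn' n) (iRt' n) (FH n).
    move=> /(_ _)/le_trans; apply; last first.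
      have wk (c x y : R) : (0 <= x -> x <= y -> c * x <= `|c| * y)%R.
        move=> x0 xy; apply: (@le_trans _ _ (`|c| * x)%R).
          by apply: ler_wpM2r => //; exact: ler_norm.
        exact: ler_wpM2l.
      apply: lerD; first apply: lerD.
      - by apply: wk => //; apply: Ex_ge0 => w; rewrite mulr_ge0// D_ge0.
      - apply: wk; last exact: leR.
        by apply: Ex_ge0 => w; rewrite mulr_ge0// Rn_ge0.
      - apply: wk; last exact: leT.
        by apply: Ex_ge0 => w; rewrite mulr_ge0// Rt_ge0.
    have q1 := ae_rcondexp (subF n) (idY n).
    have q2 := ae_rcondexp (subF n) (iRn' n).
    have q3 := ae_rcondexp (subF n) (iRt' n).
    have q5 := target_var _ (ltn0Sn n).
    apply: (filterS2 _ _ (filterI q1 q2) (filterI q3 q5)).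
    move=> w [e1 e2] [e3 tv] Hn.
    move: tv; rewrite /= e1 e2 e3 indicE mem_set/=; last exact: (HU _ _ Hn).
    by rewrite !mul1e -!EFinM -!EFinD lee_fin.
  apply: (@le_trans _ _ (\sum_(n < N)
      (`|CYD| * Ex (fun w => \1_(Hi n) w * D n.+1 w) +
       `|CYR| * rho n + `|CYH| * tau n))%R).
    by apply: ler_sum => n _; exact: leX.
  rewrite !big_split -!mulr_sumr.
  by apply: lerD; first apply: lerD; apply: ler_wpM2l => //.
have YX : {ae P, forall w, forall n, (1 <= n)%N ->
    (Y n w <= 2 * G + B2G + \sum_(k < n) X k w)%R}.
  have YV : {ae P, forall w, forall n, (Y n.+1 w <= V n.+1 w)%R}.
    by apply/ae_foralln => n; exact: Y_le_V.
  apply: (filterS2 _ _ YV (filterI B_band (ae_foralln K_top))).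
  move=> w yv [band top] [//|n] _.
  have G2 : (0 <= 2 * G)%R by rewrite mulr_ge0// ltW.
  have := @excursion_le _ (fun n => Y n.+1 w) (fun n => w \in Hi n) (2 * G) B2G
    G2 (ltW B2G_gt0) _ _ _ n.
  rewrite H0 in_set0 => /(_ isT) le.
  (* After the shift of time the excursion bound stops one summand earlier. *)
  rewrite big_ord_recr /= addrA.
  apply: (@le_trans _ _ (2 * G + B2G + \sum_(k < n) X k w)%R);
    last by rewrite lerDl.
  apply: le_trans; first apply: le.
  - move=> k /negP Hk; apply: (le_trans (yv k)).
    have [Bk|Bk] := pselect (B k w); first exact: band.
    have : (V k.+1 w <= G)%R.
      apply: (phase_low_le (v := V ^~ w)); move: Bk Hk; rewrite inE.
      rewrite /B /Hi /in_phase /mkset.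
      by case: (phase _ _ k.+1) => [[|]|].
    by move: (ltW G_gt0); lra.
  - move=> k; rewrite inE => HS /negP Hk; apply: (le_trans (yv k.+1)).
    by apply: top; apply: HK => //; move: Hk; rewrite inE.
  - by rewrite lerD2l; apply: ler_sum => k _; rewrite /X indicE.
have fin : \int[P]_w supY w < +oo.
  exact: (le_lt_trans (integral_sup_le mYT Y_ge0 iX X0 YX HX) (ltry _)).
split.
- exact: (integral_sup_eq P mYT Y_ge0).
- exact: fin.
- exact: (ae_sup_lty mYT Y_ge0 fin).
- exact: (dominated_uniformly_integrable mYT Y_ge0 fin).
Qed.
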